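(* Let $(X,\mathcal E)$ and $(Y,\mathcal F)$ be uniformly locally finite coarse spaces. The following are equivalent for an embedding $\Phi\colon\mathrm{C}^*_u(X)\to\mathrm{C}^*_u(Y)$: (1) $\Phi$ is unital, rank-preserving, and strongly continuous. (2) $\Phi$ is implemented by a unitary $u\colon\ell_2(X)\to\ell_2(Y)$, i.e. $\Phi(a)=uau^*$ for all $a\in\mathrm{C}^*_u(X)$. (3) $\Phi(\ell_\infty(X))$ is a masa of $\mathcal B(\ell_2(Y))$. (4) $\Phi(\ell_\infty(X))$ is a masa of $\mathrm{C}^*_u(Y)$.
   Context: A coarse space is a set $X$ with a family $\mathcal E$ of subsets of $X\times X$ (entourages) that contains the diagonal $\Delta_X$ and is closed under subsets, finite unions, inverses $E^{-1}=\{(y,x):(x,y)\in E\}$ and compositions $E\circ F=\{(x,y):\exists z,\ (x,z)\in E,\ (z,y)\in F\}$. It is uniformly locally finite if $\sup_{x\in X}|\{z\in X:(x,z)\in E\}|<\infty$ for all $E\in\mathcal E$. $(\delta_x)_{x\in X}$ is the canonical basis of $\ell_2(X)$. For $a\in\mathcal B(\ell_2(X))$, $\mathrm{supp}(a)=\{(x,z):\langle a\delta_z,\delta_x\rangle\neq0\}$. The uniform Roe algebra $\mathrm{C}^*_u(X)$ is the norm closure of $\{a\in\mathcal B(\ell_2(X)):\mathrm{supp}(a)\in\mathcal E\}$. $\ell_\infty(X)\subseteq\mathrm{C}^*_u(X)$ is identified with the operators that are diagonal with respect to the canonical basis. An embedding is an injective $*$-homomorphism. It is rank-preserving if it sends operators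 of rank $n$ to operators of rank $n$ for every $n\in\mathbb N$; strongly continuous means continuous with respect to the strong operator topologies. A masa is a maximal abelian self-adjoint subalgebra. *)

(* Defs.v *)
From HB Require Import structures.
From mathcomp Require Import all_boot all_order all_algebra.
From mathcomp Require Import complex.
From mathcomp Require Import all_classical all_reals all_analysis.
From mathcomp Require Import ring lra.
From mathcomp.analysis.showcase Require summability.

Set Implicit Arguments.
Unset Strict Implicit.
Unset Printing Implicit Defensive.

Import Order.TTheory GRing.Theory Num.Theory.
Import numFieldNormedType.Exports.
Import Normc.

Local Open Scope classical_set_scope.
Local Open Scope ring_scope.

Section SquareSummable.
Variables (R : realType) (X : choiceType).
Local Notation C := R[i].
Implicit Types (f g : X -> C) (c : C).

Definition sqsum f : \bar R := (\esum_(x in setT) (normc (f x) ^+ 2)%:E)%E.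

Lemma sqsum_ge0 f : (0 <= sqsum f)%E.
Proof. by apply: esum_ge0 => x _; rewrite lee_fin sqr_ge0. Qed.

Lemma sqsum_ge f (x : X) : ((normc (f x) ^+ 2)%:E <= sqsum f)%E.
Proof.
apply: esum_ge; exists [set x]; first by split => //; exact: finite_set1.
by rewrite fsbig_set1.
Qed.

Lemma esum_scale (r : R) (h : X -> R) : 0 <= r ->
  (\esum_(x in setT) (r * h x)%:E = r%:E * \esum_(x in setT) (h x)%:E)%E.
Proof.
move=> r0; rewrite /esum -ereal_supZl//; last first.
  by apply/set0P; exists (\sum_(x \in set0) (h x)%:E)%E; exists set0.
congr ereal_sup; apply/seteqP; split.
  move=> _ [A [finA _] <-]; exists (\sum_(x \in A) (h x)%:E)%E.
    by exists A.
  rewrite !fsbig_finite// !sumEFin -EFinM mulr_sumr.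
  by [].
move=> _ [_ [A [finA _] <-] <-]; exists A => //.
by rewrite !fsbig_finite// !sumEFin -EFinM mulr_sumr.
Qed.

Lemma sqsum0 : sqsum (fun=> 0) = 0%E.
Proof. by rewrite /sqsum esum1// => x _; rewrite normc0 expr0n. Qed.

Lemma sqsumZ c f : sqsum (c *: f) = ((normc c ^+ 2)%:E * sqsum f)%E.
Proof.
rewrite /sqsum -esum_scale ?sqr_ge0//; apply: eq_esum => x _.
by rewrite /= normcM exprMn.
Qed.

Lemma sqsumD_le (s : R) f g : 0 < s < 1 ->
  (sqsum (f + g)%R <= s^-1%:E * sqsum f + (1 - s)^-1%:E * sqsum g)%E.
Proof.
move=> /andP[s0 s1].
have s1' : 0 < 1 - s by rewrite subr_gt0.
have [is0 is1] : 0 <= s^-1 /\ 0 <= (1 - s)^-1 by rewrite !invr_ge0 !ltW.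
rewrite /sqsum -!esum_scale// -esumD; last 2 first.
- by move=> x _; rewrite lee_fin mulr_ge0 ?sqr_ge0.
- by move=> x _; rewrite lee_fin mulr_ge0 ?sqr_ge0.
apply: le_esum => x _; rewrite -EFinD lee_fin.
have /= := le_normcD (f x) (g x).
have ge0 (z : C) : 0 <= normc z by case: z => ? ?; exact: sqrtr_ge0.
move: (ge0 (f x)) (ge0 (g x)) (ge0 (f x + g x)).
set u := normc (f x); set v := normc (g x); set w := normc _ => u0 v0 w0 wuv.
apply: (@le_trans _ _ ((u + v) ^+ 2)); first by rewrite ler_sqr ?nnegrE ?addr_ge0.
rewrite -subr_ge0.
suff -> : s^-1 * u ^+ 2 + (1 - s)^-1 * v ^+ 2 - (u + v) ^+ 2 =
    ((1 - s) * u - s * v) ^+ 2 / (s * (1 - s)).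
  by rewrite divr_ge0 ?sqr_ge0 ?mulr_ge0 ?ltW.
by field; rewrite !gt_eqF.
Qed.

Definition l2_pred := [pred f : X -> C | (sqsum f < +oo)%E].

Lemma l2_submod_closed : submod_closed l2_pred.
Proof.
split; first by rewrite inE/= sqsum0 ltry.
have h2 : (0 : R) < 2^-1 < (1 : R) by apply/andP; split; lra.
move=> c f g; rewrite !inE/= => hf hg.
have le := @sqsumD_le _ (c *: f) g h2; apply: (le_lt_trans le).
have fin h : (sqsum h < +oo)%E -> sqsum h \is a fin_num.
  by move=> hh; rewrite ge0_fin_numE// sqsum_ge0.
rewrite sqsumZ -(fineK (fin _ hf)) -(fineK (fin _ hg)) -!EFinM -EFinD.
by rewrite ltry.
Qed.

HB.instance Definition _ :=
  GRing.isSubmodClosed.Build C (X -> C) l2_pred l2_submod_closed.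

End SquareSummable.

Section L2.
Variables (R : realType) (X : choiceType).
Local Notation C := R[i].

Record l2 := L2 { l2_fun :> X -> C ; _ : l2_pred R X l2_fun }.

HB.instance Definition _ := [isSub for l2_fun].
HB.instance Definition _ := [Choice of l2 by <:].
HB.instance Definition _ := [SubChoice_isSubLmodule of l2 by <:].

Implicit Types (xi eta : l2).

Definition l2norm xi : R := Num.sqrt (fine (sqsum xi)).

Lemma sqsum_fin xi : sqsum xi \is a fin_num.
Proof. by case: xi => f /= hf; rewrite ge0_fin_numE// sqsum_ge0. Qed.

Lemma l2norm_ge0 xi : 0 <= l2norm xi.
Proof. exact: sqrtr_ge0. Qed.

Lemma l2norm_sqr xi : (l2norm xi ^+ 2)%:E = sqsum xi.
Proof.
by rewrite sqr_sqrtr ?fine_ge0 ?sqsum_ge0// fineK// sqsum_fin.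
Qed.

Lemma l2norm_ge xi x : normc (xi x) <= l2norm xi.
Proof.
have ge0 (z : C) : 0 <= normc z by case: z => ? ?; exact: sqrtr_ge0.
rewrite -ler_sqr ?nnegrE ?l2norm_ge0// -lee_fin l2norm_sqr; exact: sqsum_ge.
Qed.

Lemma l2norm_eq0 xi : l2norm xi = 0 -> xi = 0.
Proof.
have ge0 (z : C) : 0 <= normc z by case: z => ? ?; exact: sqrtr_ge0.
move=> xi0; apply/val_inj/funext => x; apply: eq0_normc.
by apply/le_anti; rewrite ge0 -xi0 l2norm_ge.
Qed.

Lemma l2normZ (c : C) xi : l2norm (c *: xi) = normc c * l2norm xi.
Proof.
have nc0 : 0 <= normc c by case: c => ? ?; exact: sqrtr_ge0.
apply/eqP; rewrite -(@eqrXn2 _ 2)// ?mulr_ge0 ?l2norm_ge0//.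
rewrite -(inj_eq (@EFin_inj R)) exprMn [X in _ == X]EFinM !l2norm_sqr.
by rewrite -sqsumZ.
Qed.

Lemma l2normD xi eta : l2norm (xi + eta) <= l2norm xi + l2norm eta.
Proof.
have [/l2norm_eq0 ->|x0] := eqVneq (l2norm xi) 0.
  by rewrite add0r lerDr l2norm_ge0.
have [/l2norm_eq0 ->|y0] := eqVneq (l2norm eta) 0.
  by rewrite addr0 lerDl l2norm_ge0.
have {}x0 : 0 < l2norm xi by rewrite lt_neqAle eq_sym x0 l2norm_ge0.
have {}y0 : 0 < l2norm eta by rewrite lt_neqAle eq_sym y0 l2norm_ge0.
have s0 : 0 < l2norm xi + l2norm eta by rewrite addr_gt0.
rewrite -ler_sqr ?nnegrE ?addr_ge0 ?l2norm_ge0// -lee_fin l2norm_sqr.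
have h : 0 < l2norm xi / (l2norm xi + l2norm eta) < (1 : R).
  by rewrite divr_gt0//= ltr_pdivrMr// mul1r ltrDl.
have := @sqsumD_le R X _ xi eta h.
rewrite -!l2norm_sqr -!EFinM -EFinD => /le_trans; apply.
rewrite lee_fin le_eqVlt; apply/orP; left; apply/eqP.
by field; rewrite [_ + _ - _]addrAC subrr add0r !gt_eqF.
Qed.

Let norm xi : C := (l2norm xi)%:C%C.

Let norm_triangle xi eta : norm (xi + eta) <= norm xi + norm eta.
Proof. by rewrite /norm -rmorphD/= lecR l2normD. Qed.

Let norm_scale (c : C) xi : norm (c *: xi) = `|c| * norm xi.
Proof. by rewrite /norm l2normZ rmorphM. Qed.

Let norm_eq0 xi : norm xi = 0 -> xi = 0.
Proof. by move=> [] /l2norm_eq0. Qed.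

HB.instance Definition _ :=
  Lmodule_isNormed.Build C l2 norm_triangle norm_scale norm_eq0.

Lemma l2_normE xi : `|xi| = (l2norm xi)%:C%C.
Proof. by []. Qed.

Definition delta_fun (x : X) : X -> C := fun z => (z == x)%:R.

Lemma delta_l2 x : l2_pred R X (delta_fun x).
Proof.
rewrite /=; suff -> : sqsum (delta_fun x) =
    (\esum_(z in setT) if z \in [set x] then 1%:E else 0)%E.
  by rewrite -esum_mkcond esum_set1// ltry.
apply: eq_esum => z _; rewrite /delta_fun; case: eqP => [->|zx].
  by rewrite mem_set// normc1 expr1n.
by rewrite memNset// normc0 expr0n.
Qed.

Definition delta (x : X) : l2 := L2 (delta_l2 x).

(* Linear in the first variable.  The sum is the limit of the net of finite
   partial sums. *)
Definition dot xi eta : C :=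
  summability.sum (fun x : X => (xi x * (eta x)^* : C^o)).

End L2.

Notation "''[' u , v ]" := (dot u v) : ring_scope.

Section Operators.
Variable R : realType.
Local Notation C := R[i].
Local Notation l2 := (l2 R).
Implicit Types X Y : choiceType.

Definition bounded_op X Y : set (l2 X -> l2 Y) :=
  [set a | linear a /\
    exists M : R, forall xi, l2norm (a xi) <= M * l2norm xi].

Definition opnorm X Y (a : l2 X -> l2 Y) : R :=
  sup [set l2norm (a xi) | xi in [set xi | l2norm xi <= 1]].

(* The adjoint of a bounded operator exists by the Riesz representation
   theorem, and it is unique; off the bounded operators this is junk. *)
Definition adjoint X Y (a : l2 X -> l2 Y) : l2 Y -> l2 X :=
  xget (fun=> 0) [set b | forall xi eta, '[a xi, eta] = '[xi, b eta]].

Definition unitary X Y (u : l2 X -> l2 Y) : Prop :=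
  [/\ bounded_op u, adjoint u \o u = id & u \o adjoint u = id].

Definition supp X (a : l2 X -> l2 X) : set (X * X) :=
  [set p | '[a (delta R p.2), delta R p.1] != 0].

Definition has_rank X (n : nat) (a : l2 X -> l2 X) : Prop :=
  exists v : 'I_n -> l2 X,
    (forall c : 'I_n -> C, \sum_i c i *: v i = 0 -> forall i, c i = 0) /\
    range a = [set \sum_i c i *: v i | c in [set: 'I_n -> C]].

Definition linfty X : set (l2 X -> l2 X) :=
  [set a | bounded_op a /\ supp a `<=` diagonal].

Definition abelian_sa_subalg X (A M : set (l2 X -> l2 X)) : Prop :=
  [/\ M `<=` A,
      M 0 /\ forall (c : C) a b, M a -> M b -> M (c *: a + b),
      forall a b, M a -> M b -> M (a \o b),
      forall a, M a -> M (adjoint a) &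
      forall a b, M a -> M b -> a \o b = b \o a].

(* Norm-closedness is not imposed: it follows from maximality when A is a
   norm-closed algebra. *)
Definition masa X (A M : set (l2 X -> l2 X)) : Prop :=
  abelian_sa_subalg A M /\
  forall N, abelian_sa_subalg A N -> M `<=` N -> N = M.

End Operators.

Section Coarse.
Variable X : choiceType.
Implicit Types (E : set (set (X * X))) (A B : set (X * X)).

Record coarse_space E : Prop := CoarseSpace {
  coarse_diag : E diagonal;
  coarse_sub : forall A B, B `<=` A -> E A -> E B;
  coarse_union : forall A B, E A -> E B -> E (A `|` B);
  coarse_inv : forall A, E A -> E [set p | A (p.2, p.1)];
  coarse_comp : forall A B, E A -> E B ->
    E [set p | exists z, A (p.1, z) /\ B (z, p.2)] }.

Definition uniformly_locally_finite E : Prop :=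
  forall A, E A -> exists n : nat, forall x, ([set z | A (x, z)] #<= `I_n)%card.

Variable R : realType.

Definition uniform_roe E : set (l2 R X -> l2 R X) :=
  [set a | bounded_op a /\
    forall eps : R, 0 < eps ->
      exists b, [/\ bounded_op b, E (supp b) & opnorm (a - b) < eps]].

End Coarse.

Section Embeddings.
Variables (R : realType) (X Y : choiceType).
Local Notation C := R[i].
Implicit Types (A : set (l2 R X -> l2 R X)) (B : set (l2 R Y -> l2 R Y)).
Implicit Types (Phi : (l2 R X -> l2 R X) -> l2 R Y -> l2 R Y).

(* A map A -> B is represented by a total function on all maps
   l2 R X -> l2 R X, of which only the values on A are used. *)
Record embedding A B Phi : Prop := Embedding {
  emb_fun : forall a, A a -> B (Phi a);
  emb_linear : forall (c : C) a b, A a -> A b ->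
    Phi (c *: a + b) = c *: Phi a + Phi b;
  emb_mul : forall a b, A a -> A b -> Phi (a \o b) = Phi a \o Phi b;
  emb_adjoint : forall a, A a -> Phi (adjoint a) = adjoint (Phi a);
  emb_inj : {in A &, injective Phi} }.

Definition rank_preserving A Phi : Prop :=
  forall (n : nat) a, A a -> has_rank n a -> has_rank n (Phi a).

(* The strong operator topology is the topology of pointwise convergence. *)
Definition strongly_continuous A Phi : Prop :=
  {within (A : set {ptws l2 R X -> l2 R X}),
    continuous (Phi : {ptws l2 R X -> l2 R X} -> {ptws l2 R Y -> l2 R Y})}.

Definition implemented_by A Phi (u : l2 R X -> l2 R Y) : Prop :=
  forall a, A a -> Phi a = u \o a \o adjoint u.

End Embeddings.

Arguments bounded_op R X Y : clear implicits.
Arguments linfty R X : clear implicits.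
Arguments uniform_roe {X} R E.

(* Main.v *)
(** Write [P S] for [Phi] applied to the indicator of [S].

    A rank-preserving, strongly continuous [Phi] yields unit vectors spanning
    the ranges of the [P [set x]]; images of matrix units make their phases
    coherent along the coarse components of [X], and the resulting orthonormal
    basis gives the unitary.

    The substance is that, if the image M of [linfty] is a masa of the Roe
    algebra of [Y], then the [P [set x]] have rank one and no [v != 0] is killed
    by all of them.  Let [v] be a vector on which [P] is bounded below along an
    ultrafilter U on [X].  Compressing the matrix unit at a suitable [delta y] by
    the [P S] with [S] in U gives in the limit a rank-one operator in the Roe
    algebra that commutes with M, hence lies in M, and this forces U to be
    principal.  Principal ultrafilters thus give rank one; and if every
    [P [set x]] kills [v], there are finite partitions of [X] all of whose
    pieces are small on [v].  On such partitions random signs [r] make all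
    coordinates of [Phi r v] uniformly small, by a fourth moment estimate.
    Gluing such signs on infinitely many disjoint subsets of [X] gives an [r]
    for which [Phi r] is not approximable by operators with uniformly finitely
    many entries per column. *)
Require Import Defs.
From HB Require Import structures.
From mathcomp Require Import all_boot all_order all_algebra finmap.
From mathcomp Require Import complex.
From mathcomp Require Import all_classical all_reals all_analysis.
From mathcomp Require Import ring lra.
From mathcomp.analysis.showcase Require Import summability.

Set Implicit Arguments.
Unset Strict Implicit.
Unset Printing Implicit Defensive.

Import Order.TTheory GRing.Theory Num.Theory.
Import numFieldNormedType.Exports.
Import Normc.

Local Open Scope classical_set_scope.
Local Open Scope ring_scope.

(** Under the masa conditions [Phi] is not known to be strongly continuous, so [P] is only a
    finitely additive projection-valued measure on the subsets of X, and a diffuse part carried by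
    nonprincipal ultrafilters has to be excluded. Maximality inside the Roe algebra can be applied
    to a projection only once it is known to lie there. This is why matrix units at points of Y are
    compressed: they lie in the Roe algebra, and the norm of [P S (delta y)] decreases as S shrinks,
    so the compressions converge in operator norm. Small pieces control coordinates because the
    coordinate at z of a piece of v is its inner product with the matching piece of [delta z], and
    the squared norms of the latter add up to 1. Second moments only return the norm of v; fourth
    moments, summed over all z, gain a factor tending to 0 and bound all coordinates at once. The
    column bound n of an approximant is known only after r is fixed. So the nth disjoint subset is
    prepared against the bound n: a unit vector with tiny coordinates cannot have most of its mass
    on boundedly many points. *)

Section ComplexNorm.
Variable R : realType.
Local Notation C := R[i].
Implicit Types z w : C.

Lemma normc_ge0 z : 0 <= normc z.
Proof. by case: z => ? ?; exact: sqrtr_ge0. Qed.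

Lemma mulJc z : z * z^* = (normc z ^+ 2)%:C%C.
Proof. by rewrite -normCK rmorphXn. Qed.

Lemma normcJr z : normc z^* = normc z.
Proof. by apply: complexI; have := norm_conjC z. Qed.

Lemma real_complex_conj (r : R) : (r%:C%C)^* = r%:C%C :> C.
Proof. exact: conjc_real. Qed.

Lemma normc_real (r : R) : normc r%:C%C = `|r|.
Proof. by rewrite /normc /= expr0n addr0 sqrtr_sqr. Qed.

Lemma complex_lt_real (e : C) : 0 < e -> exists2 d : R, 0 < d & e = d%:C%C.
Proof.
move=> e0; exists (complex.Re e); first by move: e0; rewrite ltcE /= => /andP[].
by apply/esym/RRe_real; rewrite realE ltW.
Qed.

End ComplexNorm.

(** * Unconditional sums of complex families *)

Section Sums.
Variables (R : realType) (X : choiceType).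
Local Notation C := R[i].
Local Existing Instance totally_filter.

Definition sumto (f : X -> C) (l : C) :=
  partial_sum (f : X -> C^o) @ totally --> (l : C^o).

Lemma partial_sumE (V : zmodType) (f : X -> V) (A : {fset X}) :
  partial_sum f A = \sum_(x <- A) f x.
Proof. by rewrite /partial_sum big_seq_fsetE. Qed.

Lemma sumto_unique f l l' : sumto f l -> sumto f l' -> l = l'.
Proof. by move=> fl fl'; apply: cvg_unique fl fl'; exact: norm_hausdorff. Qed.

Lemma sumtoP f l : sumto f l <-> forall e : R, 0 < e ->
  exists A : {fset X}, forall B : {fset X}, (A `<=` B)%fset ->
    normc (l - \sum_(x <- B) f x) < e.
Proof.
split.
  move=> /(@cvgrPdist_lt C C^o) fl e e0.
  have /fl [A _ AP] : (0 : C) < e%:C%C by rewrite ltcR.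
  exists A => B AB; rewrite -ltcR -partial_sumE; exact: AP.
move=> H; apply/(@cvgrPdist_lt C C^o) => _ /complex_lt_real [e e0 ->].
have [A AP] := H _ e0; exists A => // B /= AB.
by have := AP _ AB; rewrite -ltcR -partial_sumE.
Qed.

Lemma sumtoD f g l m : sumto f l -> sumto g m ->
  sumto (fun x => f x + g x) (l + m).
Proof.
move=> /sumtoP fl /sumtoP gm; apply/sumtoP => e e0.
have e2 : 0 < e / 2 by rewrite divr_gt0.
have [A AP] := fl _ e2; have [B BP] := gm _ e2.
exists (A `|` B)%fset => D; rewrite fsubUset => /andP[AD BD].
rewrite big_split /= opprD addrACA.
apply: le_lt_trans (le_normcD _ _) _.
by rewrite (splitr e) ltrD// ?AP ?BP.
Qed.

Lemma sumtoZ c f l : sumto f l -> sumto (fun x => c * f x) (c * l).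
Proof.
move=> /sumtoP fl; apply/sumtoP => e e0.
have c1 : 0 < normc c + 1 by rewrite ltr_wpDl// normc_ge0.
have [A AP] := fl _ (divr_gt0 e0 c1); exists A => B AB.
rewrite -mulr_sumr -mulrBr normcM.
have := AP _ AB; rewrite ltr_pdivlMr// => H.
apply: le_lt_trans H; rewrite mulrC ler_wpM2l ?normc_ge0// lerDl//.
Qed.

Lemma sumto_conj f l : sumto f l -> sumto (fun x => (f x)^*) l^*.
Proof.
move=> /sumtoP fl; apply/sumtoP => e e0; have [A AP] := fl _ e0.
by exists A => B AB; rewrite -rmorph_sum -rmorphB normcJr AP.
Qed.

(** Bridge between the two kinds of sums: norms are suprema of finite sums in the extended reals,
    [dot] is a limit along the net of finite sets. *)
Lemma sumto_esum (h : X -> R) : (forall x, 0 <= h x) ->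
  (\esum_(x in setT) (h x)%:E < +oo)%E ->
  sumto (fun x => (h x)%:C%C) (fine (\esum_(x in setT) (h x)%:E))%:C%C.
Proof.
move=> h0 hfin; apply/sumtoP => e e0.
have fin : (\esum_(x in setT) (h x)%:E)%E \is a fin_num.
  by rewrite ge0_fin_numE// esum_ge0// => x _; rewrite lee_fin.
have /(ub_ereal_sup_adherent e0) : ereal_sup [set \sum_(x \in A) (h x)%:E
    | A in fsets setT]%E \is a fin_num by [].
rewrite -/(esum setT _) => -[_ [A [finA _] <-]].
rewrite fsbig_finite//= sumEFin -(fineK fin) -EFinB lte_fin => lA.
exists (fset_set A) => B AB.
have leB : \sum_(x <- B) h x <= fine (\esum_(x in setT) (h x)%:E).
  rewrite -lee_fin fineK// -sumEFin.
  apply: ereal_sup_ubound; exists [set` B]; first by split.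
  by rewrite fsbig_finite//= set_fsetK.
have leAB : \sum_(x <- fset_set A) h x <= \sum_(x <- B) h x.
  rewrite (big_fsetID _ (mem (fset_set A)) B) /=.
  have -> : [fset x in B | x \in fset_set A]%fset = fset_set A.
    apply/fsetP => x; rewrite !inE /= andbC.
    by case: (boolP (x \in fset_set A)) => //= /(fsubsetP AB) ->.
  by rewrite lerDl sumr_ge0.
rewrite -(rmorph_sum (real_complex R)) -rmorphB normc_real ger0_norm ?subr_ge0//.
by rewrite ltrBlDr -ltrBlDl; apply: lt_le_trans leAB.
Qed.

End Sums.
Arguments sumtoZ {R X} c {f l}.

(** * Inner product and norm of l2 *)

Section Dot.
Local Existing Instance totally_filter.
Variables (R : realType) (X : choiceType).
Local Notation C := R[i].
Local Notation H := (l2 R X).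
Implicit Types (xi eta zeta : H) (c : C).

Lemma l2DE xi eta x : (xi + eta) x = xi x + eta x. Proof. by []. Qed.
Lemma l2ZE c xi x : (c *: xi) x = c * xi x. Proof. by []. Qed.
Lemma l2NE xi x : (- xi) x = - xi x. Proof. by []. Qed.
Lemma l20E x : (0 : H) x = 0. Proof. by []. Qed.
Lemma l2_sumE (I : Type) (s : seq I) (P : pred I) (f : I -> H) x :
  (\sum_(i <- s | P i) f i) x = \sum_(i <- s | P i) f i x.
Proof. by elim/big_rec2: _ => // i a b _ <-. Qed.
Lemma deltaE (x z : X) : delta R x z = (z == x)%:R. Proof. by []. Qed.
Lemma l2P xi eta : (forall x, xi x = eta x) -> xi = eta.
Proof. by move=> h; apply/val_inj/funext. Qed.

Lemma sqsum_lty xi : (sqsum xi < +oo)%E.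
Proof. by case: xi. Qed.

Lemma l2norm_sqrE xi : l2norm xi ^+ 2 = fine (sqsum xi).
Proof. by rewrite sqr_sqrtr// fine_ge0// sqsum_ge0. Qed.

Lemma sumto_sqr xi :
  sumto (fun x => (normc (xi x) ^+ 2)%:C%C) (l2norm xi ^+ 2)%:C%C.
Proof.
rewrite l2norm_sqrE; apply: sumto_esum => [x|]; first exact: sqr_ge0.
exact: sqsum_lty.
Qed.

Arguments sumto_sqr : clear implicits.

(** Writes the terms of an inner product through squared moduli, whose sums are known to converge;
    no theory of absolute convergence is needed. *)
Lemma polarization (z w : C) : z * w^* =
  4^-1 * ((normc (z + w) ^+ 2)%:C%C
          + -1 * (normc (z + (-1) * w) ^+ 2)%:C%C
          + 'i * (normc (z + 'i * w) ^+ 2)%:C%C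
          + - 'i * (normc (z + (- 'i) * w) ^+ 2)%:C%C).
Proof.
rewrite -!mulJc !rmorphD !rmorphM !rmorphN rmorph1 /= conjCi.
have ii : 'i * 'i = -1 :> C by rewrite -expr2 sqrCi.
have -> : 4^-1 * (((z + w) * (z^* + w^*) +
   -1 * ((z + -1 * w) * (z^* + -1 * w^*)) +
   'i * ((z + 'i * w) * (z^* + - 'i * w^*)) +
   - 'i * ((z + - 'i * w) * (z^* + - - 'i * w^*)))) =
   4^-1 * (2 * (z * w^*) + 2 * (z^* * w) - 2 * ('i * 'i) * (z * w^*) +
           2 * ('i * 'i) * (z^* * w)) by ring.
by rewrite ii; field.
Qed.

(** [dot] is defined as a limit that might not exist. By polarization the series is a combination of
    four convergent ones; every algebraic rule for [dot] then follows from uniqueness of limits. *)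
Lemma dot_sumto xi eta : sumto (fun x => xi x * (eta x)^*) '[xi, eta].
Proof.
suff [l lP] : exists l, sumto (fun x => xi x * (eta x)^*) l.
  suff -> : '[xi, eta] = l by [].
  apply: (@cvg_lim C^o) lP; exact: (@norm_hausdorff _ C^o).
eexists; rewrite (_ : (fun _ => _) = fun x => 4^-1 *
   ((normc ((xi + eta) x) ^+ 2)%:C%C
   + -1 * (normc ((xi + (-1) *: eta) x) ^+ 2)%:C%C
   + 'i * (normc ((xi + 'i *: eta) x) ^+ 2)%:C%C
   + - 'i * (normc ((xi + (- 'i) *: eta) x) ^+ 2)%:C%C)); last first.
  by apply/funext => x; rewrite polarization.
apply: sumtoZ; apply: sumtoD; last by apply: sumtoZ; exact: sumto_sqr.
apply: sumtoD; last by apply: sumtoZ; exact: sumto_sqr.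
apply: sumtoD; last by apply: sumtoZ; exact: sumto_sqr.
exact: sumto_sqr.
Qed.

Arguments dot_sumto : clear implicits.

Lemma dotDl xi eta zeta : '[xi + eta, zeta] = '[xi, zeta] + '[eta, zeta].
Proof.
refine (sumto_unique (dot_sumto _ _) _).
have := sumtoD (dot_sumto xi zeta) (dot_sumto eta zeta).
by congr sumto; apply/funext => x; rewrite -mulrDl.
Qed.

Lemma dotZl c xi zeta : '[c *: xi, zeta] = c * '[xi, zeta].
Proof.
refine (sumto_unique (dot_sumto _ _) _).
have := sumtoZ c (dot_sumto xi zeta).
by congr sumto; apply/funext => x; rewrite mulrA.
Qed.

Lemma dotC xi eta : '[xi, eta] = '[eta, xi]^*.
Proof.
refine (sumto_unique (dot_sumto _ _) _).
have := sumto_conj (dot_sumto eta xi).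
by congr sumto; apply/funext => x; rewrite rmorphM/= conjCK mulrC.
Qed.

Lemma dotxx xi : '[xi, xi] = (l2norm xi ^+ 2)%:C%C.
Proof.
refine (sumto_unique (dot_sumto _ _) _).
have := sumto_sqr xi.
by congr sumto; apply/funext => x; rewrite mulJc.
Qed.

Lemma dot_deltar xi x : '[xi, delta R x] = xi x.
Proof.
apply: sumto_unique (dot_sumto _ _) _; apply/sumtoP => e e0.
exists [fset x]%fset => B /fsubsetP xB.
have {}xB : x \in B by apply: xB; rewrite inE.
rewrite (big_fsetD1 x)// deltaE eqxx rmorph1 mulr1.
rewrite big1_seq => [|z /andP[_]]; first by rewrite /= addr0 subrr normc0.
by rewrite in_fsetD1 deltaE => /andP[/negbTE -> _]; rewrite rmorph0 mulr0.
Qed.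

Lemma dotDr xi eta zeta : '[xi, eta + zeta] = '[xi, eta] + '[xi, zeta].
Proof. by rewrite dotC dotDl rmorphD/= -!dotC. Qed.
Lemma dotZr c xi zeta : '[xi, c *: zeta] = c^* * '[xi, zeta].
Proof. by rewrite dotC dotZl rmorphM/= -dotC. Qed.
Lemma dotNl xi eta : '[- xi, eta] = - '[xi, eta].
Proof. by rewrite -scaleN1r dotZl mulN1r. Qed.
Lemma dotNr xi eta : '[xi, - eta] = - '[xi, eta].
Proof. by rewrite dotC dotNl rmorphN/= -dotC. Qed.
Lemma dotBl xi eta zeta : '[xi - eta, zeta] = '[xi, zeta] - '[eta, zeta].
Proof. by rewrite dotDl dotNl. Qed.
Lemma dotBr xi eta zeta : '[xi, eta - zeta] = '[xi, eta] - '[xi, zeta].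
Proof. by rewrite dotDr dotNr. Qed.
Lemma dot0l xi : '[0, xi] = 0.
Proof. by rewrite -(scale0r xi) dotZl mul0r. Qed.
Lemma dot0r xi : '[xi, 0] = 0.
Proof. by rewrite dotC dot0l rmorph0. Qed.
Lemma dot_suml (I : Type) (s : seq I) (P : pred I) (f : I -> H) xi :
  '[\sum_(i <- s | P i) f i, xi] = \sum_(i <- s | P i) '[f i, xi].
Proof. by elim/big_rec2: _ => [|i a b _ <-]; rewrite ?dot0l// dotDl. Qed.
Lemma dot_sumr (I : Type) (s : seq I) (P : pred I) (f : I -> H) xi :
  '[xi, \sum_(i <- s | P i) f i] = \sum_(i <- s | P i) '[xi, f i].
Proof. by elim/big_rec2: _ => [|i a b _ <-]; rewrite ?dot0r// dotDr. Qed.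
Lemma dot_deltal xi x : '[delta R x, xi] = (xi x)^*.
Proof. by rewrite dotC dot_deltar. Qed.

Lemma dot_inj xi eta : (forall zeta, '[xi, zeta] = '[eta, zeta]) -> xi = eta.
Proof. by move=> h; apply: l2P => x; rewrite -!dot_deltar. Qed.
Lemma dot_injr xi eta : (forall zeta, '[zeta, xi] = '[zeta, eta]) -> xi = eta.
Proof. by move=> h; apply: dot_inj => z; rewrite dotC h -dotC. Qed.

Lemma l2norm0 : l2norm (0 : H) = 0.
Proof. by rewrite /l2norm sqsum0 sqrtr0. Qed.
Lemma l2normN xi : l2norm (- xi) = l2norm xi.
Proof. by rewrite -scaleN1r l2normZ (_ : normc (-1) = 1) ?mul1r// normcN normc1. Qed.
Lemma l2normB_le xi eta : l2norm (xi - eta) <= l2norm xi + l2norm eta.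
Proof. by rewrite -(l2normN eta); exact: l2normD. Qed.
Lemma l2norm_delta x : l2norm (delta R x : H) = 1.
Proof.
apply/eqP; rewrite -(@eqrXn2 _ 2) ?l2norm_ge0// expr1n; apply/eqP/complexI.
by rewrite -dotxx dot_deltar deltaE eqxx.
Qed.
Lemma l2norm_gt0 xi : xi != 0 -> 0 < l2norm xi.
Proof.
move=> x0; rewrite lt_neqAle l2norm_ge0 andbT eq_sym.
by apply: contra x0 => /eqP/l2norm_eq0 ->.
Qed.
Lemma l2norm_sum (I : Type) (s : seq I) (P : pred I) (f : I -> H) :
  l2norm (\sum_(i <- s | P i) f i) <= \sum_(i <- s | P i) l2norm (f i).
Proof.
elim/big_rec2: _ => [|i a b _ h]; first by rewrite l2norm0.
by apply: le_trans (l2normD _ _) _; rewrite lerD2l.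
Qed.

Lemma pythagoras xi eta : '[xi, eta] = 0 ->
  l2norm (xi + eta) ^+ 2 = l2norm xi ^+ 2 + l2norm eta ^+ 2.
Proof.
move=> o; apply: complexI; rewrite rmorphD/= -!dotxx dotDl !dotDr o.
by rewrite (dotC eta xi) o rmorph0 addr0 add0r.
Qed.

Lemma pythagoras_sum (I : eqType) (s : seq I) (f : I -> H) : uniq s ->
  (forall i j, i != j -> '[f i, f j] = 0) ->
  l2norm (\sum_(i <- s) f i) ^+ 2 = \sum_(i <- s) l2norm (f i) ^+ 2.
Proof.
move=> us o; elim: s us => [|i s IH] /=; first by rewrite !big_nil l2norm0 expr0n.
move=> /andP[si us]; rewrite !big_cons pythagoras ?IH//.
rewrite dot_sumr big1_seq// => j /= js; apply: o.
by apply: contra si => /eqP ->.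
Qed.

Lemma normc_dot_le xi eta : normc '[xi, eta] <= l2norm xi * l2norm eta.
Proof.
have [->|e0] := eqVneq eta 0; first by rewrite dot0r normc0 l2norm0 mulr0.
have {}e0 := l2norm_gt0 e0.
set s := '[xi, eta]; set t := l2norm eta; set u := l2norm xi.
have o : '[xi - (s / (t ^+ 2)%:C%C) *: eta, (s / (t ^+ 2)%:C%C) *: eta] = 0.
  rewrite dotZr dotBl dotZl dotxx -/s -/t divfK ?subrr ?mulr0//.
  by rewrite (inj_eq (@complexI R) _ 0) expf_eq0 gt_eqF.
have := pythagoras o; rewrite subrK l2normZ normcM normcV normc_real -/u -/t.
rewrite ger0_norm ?sqr_ge0// => e.
have : (normc s * (t ^+ 2)^-1 * t) ^+ 2 <= u ^+ 2 by rewrite e lerDr sqr_ge0.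
rewrite ler_sqr ?nnegrE ?mulr_ge0 ?invr_ge0 ?normc_ge0 ?sqr_ge0 ?l2norm_ge0//.
rewrite (_ : _ * _ * t = normc s / t); last by field; rewrite gt_eqF.
by rewrite ler_pdivrMr.
Qed.

Lemma l2norm_le_dot xi (M : R) : 0 <= M ->
  (forall eta, normc '[xi, eta] <= M * l2norm eta) -> l2norm xi <= M.
Proof.
move=> M0 h; have [->|x0] := eqVneq xi 0; first by rewrite l2norm0.
have {}x0 := l2norm_gt0 x0.
have := h xi; rewrite dotxx normc_real ger0_norm ?sqr_ge0// expr2.
by rewrite ler_pM2r.
Qed.

Lemma l2norm_fin_le xi (A : {fset X}) :
  \sum_(x <- A) normc (xi x) ^+ 2 <= l2norm xi ^+ 2.
Proof.
rewrite -lee_fin l2norm_sqr -sumEFin; apply: ereal_sup_ubound.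
by exists [set` A]; [split|rewrite fsbig_finite//= set_fsetK].
Qed.

Lemma l2_pred_fin (f : X -> C) (M : R) :
  (forall A : {fset X}, \sum_(x <- A) normc (f x) ^+ 2 <= M) ->
  (sqsum f <= M%:E)%E.
Proof.
move=> h; apply: ge_ereal_sup => _ [A [finA _] <-].
by rewrite fsbig_finite//= sumEFin lee_fin.
Qed.

End Dot.

Lemma real_cauchy_cvg (R : realType) (u : nat -> R) :
  (forall e, 0 < e -> exists N, forall m n, (N <= m)%N -> (N <= n)%N ->
     `|u m - u n| < e) ->
  exists l, forall e, 0 < e -> exists N, forall n, (N <= n)%N -> `|l - u n| < e.
Proof.
move=> H; suff /cvg_ex [l /cvgrPdist_lt ul] : cvg (u @ \oo).
  by exists l => e /ul [N _ HN]; exists N => n Nn; exact: HN.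
apply/cauchy_cvgP/cauchy_ballP => e /H [N HN].
exists (u @` [set n | (N <= n)%N], u @` [set n | (N <= n)%N]) => /=.
  by split; exists N => // n /= Nn; exists n.
by move=> [_ _] /= [[m Nm <-] [n Nn <-]]; exact: HN.
Qed.

Lemma complex_cauchy_cvg (R : realType) (u : nat -> R[i]) :
  (forall e, 0 < e -> exists N, forall m n, (N <= m)%N -> (N <= n)%N ->
     normc (u m - u n) < e) ->
  exists l, forall e, 0 < e -> exists N, forall n, (N <= n)%N -> normc (l - u n) < e.
Proof.
move=> H.
have Re_le (z : R[i]) : `|complex.Re z| <= normc z.
  by rewrite -lecR; exact: normc_ge_Re.
have Im_le (z : R[i]) : `|complex.Im z| <= normc z.
  case: z => a b; rewrite /normc /= -sqrtr_sqr ler_sqrt ?lerDr ?sqr_ge0//.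
  by rewrite addr_ge0 ?sqr_ge0.
have [|a aP] := @real_cauchy_cvg R (fun n => complex.Re (u n)).
  move=> e /H [N HN]; exists N => m n Nm Nn.
  apply: le_lt_trans (HN _ _ Nm Nn).
  by have := Re_le (u m - u n); case: (u m); case: (u n).
have [|b bP] := @real_cauchy_cvg R (fun n => complex.Im (u n)).
  move=> e /H [N HN]; exists N => m n Nm Nn.
  apply: le_lt_trans (HN _ _ Nm Nn).
  by have := Im_le (u m - u n); case: (u m); case: (u n).
exists (Complex a b) => e e0.
have e2 : 0 < e / 2 by rewrite divr_gt0.
have [N1 H1] := aP _ e2; have [N2 H2] := bP _ e2.
exists (maxn N1 N2) => n; rewrite geq_max => /andP[n1 n2].
rewrite [X in normc X]complexE; apply: le_lt_trans (le_normcD _ _) _.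
rewrite normcM !normc_real (_ : normc 'i%C = 1); last first.
  by rewrite /normc /= expr0n add0r expr1n sqrtr1.
rewrite mul1r (splitr e) ltrD//.
  by have := H1 _ n1; case: (u n).
by have := H2 _ n2; case: (u n).
Qed.

(** * Finite truncations, density and completeness *)

Section Truncation.
Variables (R : realType) (X : choiceType).
Local Notation C := R[i].
Local Notation H := (l2 R X).
Implicit Types (xi eta zeta : H) (c : C) (A : {fset X}).

Definition fin_comb (A : {fset X}) (f : X -> C) : H :=
  \sum_(x <- A) f x *: delta R x.

Lemma fin_combE A f x : fin_comb A f x = if x \in A then f x else 0.
Proof.
rewrite l2_sumE; under eq_bigr do rewrite l2ZE deltaE.
case: ifPn => xA.
  rewrite (big_fsetD1 x)// eqxx mulr1 big1_seq => [|z /andP[_]]; first by rewrite /= addr0.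
  by rewrite in_fsetD1 eq_sym => /andP[/negbTE -> _]; rewrite mulr0.
rewrite big1_seq// => z /andP[_ zA]; case: eqP => [e|]; last by rewrite mulr0.
by rewrite e zA in xA.
Qed.

Lemma dot_fin_comb A f eta :
  '[fin_comb A f, eta] = \sum_(x <- A) f x * (eta x)^*.
Proof.
by rewrite dot_suml; apply: eq_bigr => x _; rewrite dotZl dot_deltal.
Qed.

Lemma l2norm_fin_comb A f :
  l2norm (fin_comb A f) ^+ 2 = \sum_(x <- A) normc (f x) ^+ 2.
Proof.
apply: complexI; rewrite -dotxx dot_fin_comb rmorph_sum big_seq [RHS]big_seq.
by apply: eq_bigr => x xA; rewrite fin_combE xA mulJc.
Qed.

Lemma l2norm_fin_comb_le A f : l2norm (fin_comb A f) <= \sum_(x <- A) normc (f x).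
Proof.
apply: le_trans (l2norm_sum _ _ _) _; apply: ler_sum => x _.
by rewrite l2normZ l2norm_delta mulr1.
Qed.

Lemma l2norm_trunc xi A :
  l2norm xi ^+ 2 = l2norm (xi - fin_comb A xi) ^+ 2
                   + \sum_(x <- A) normc (xi x) ^+ 2.
Proof.
rewrite -l2norm_fin_comb -pythagoras ?subrK// dotC dot_fin_comb.
rewrite big1_seq ?rmorph0// => x /andP[_ xA].
by rewrite l2DE l2NE fin_combE xA subrr rmorph0 mulr0.
Qed.

Lemma l2norm_trunc_le xi A : l2norm (fin_comb A xi) <= l2norm xi.
Proof.
by rewrite -ler_sqr ?nnegrE ?l2norm_ge0// l2norm_fin_comb l2norm_fin_le.
Qed.

Lemma trunc_approx xi (e : R) : 0 < e -> exists A : {fset X},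
  forall B : {fset X}, (A `<=` B)%fset -> l2norm (xi - fin_comb B xi) < e.
Proof.
move=> e0; have /sumtoP/(_ _ (exprn_gt0 2 e0)) [A AP] := @sumto_sqr _ _ xi.
exists A => B /AP; rewrite (l2norm_trunc xi B).
rewrite -rmorph_sum -rmorphB addrK normc_real ger0_norm ?sqr_ge0//.
by rewrite ltr_sqr ?nnegrE ?l2norm_ge0// ltW.
Qed.

(** Density of the finite combinations: [phi] kills every truncation of [xi], so it only sees the
    tail, whose norm is arbitrarily small. *)
Lemma functional_ext (phi : H -> C) (K : R) :
  (forall c xi eta, phi (c *: xi + eta) = c * phi xi + phi eta) ->
  (forall xi, normc (phi xi) <= K * l2norm xi) ->
  (forall x, phi (delta R x) = 0) -> forall xi, phi xi = 0.
Proof.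
move=> lin bd phi0 xi.
have p0 : phi 0 = 0.
  by apply/eqP; have := lin 1 0 0; rewrite scale1r mul1r addr0 => /eqP; rewrite -subr_eq subrr eq_sym.
have phiA A f : phi (fin_comb A f) = 0.
  rewrite /fin_comb; elim/big_rec: _ => // x v _ pv.
  by rewrite lin phi0 pv mulr0 addr0.
apply: eq0_normc; apply/le_anti; rewrite normc_ge0 andbT.
apply/ler_addgt0Pr => e e0; rewrite add0r.
have K1 : 0 < `|K| + 1 by rewrite ltr_wpDl.
have [A /(_ _ (fsubset_refl A)) AP] := trunc_approx xi (divr_gt0 e0 K1).
have -> : phi xi = phi (xi - fin_comb A xi).
  have := lin 1 (xi - fin_comb A xi) (fin_comb A xi).
  by rewrite scale1r subrK mul1r phiA addr0.
apply: le_trans (bd _) _; apply: le_trans (_ : (`|K| + 1) * l2norm (xi - fin_comb A xi) <= _).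
  rewrite ler_wpM2r ?l2norm_ge0//; apply: le_trans (ler_norm _) _.
  by rewrite lerDl.
by move: AP; rewrite ltr_pdivlMr// mulrC => /ltW.
Qed.

(** The limit is taken coordinatewise. The Cauchy bound is transferred to it on each finite set and
    then to the full norm, a supremum over finite sets. *)
Lemma l2_complete (u : nat -> H) :
  (forall e, 0 < e -> exists N, forall m n, (N <= m)%N -> (N <= n)%N ->
     l2norm (u m - u n) < e) ->
  exists w, forall e, 0 < e ->
    exists N, forall n, (N <= n)%N -> l2norm (w - u n) <= e.
Proof.
move=> Hu.
have /choice [f fP] x : exists l, forall e, 0 < e ->
    exists N, forall n, (N <= n)%N -> normc (l - u n x) < e.
  apply: complex_cauchy_cvg => e /Hu [N HN]; exists N => m n Nm Nn.
  exact: le_lt_trans (l2norm_ge (u m - u n) x) (HN _ _ Nm Nn).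
have key e N : 0 < e -> (forall m n, (N <= m)%N -> (N <= n)%N ->
    l2norm (u m - u n) < e) -> forall n A, (N <= n)%N ->
    l2norm (fin_comb A (fun x => f x - u n x)) <= e.
  move=> e0 HN n A Nn; apply/ler_addgt0Pr => d d0.
  (* On the finite set [A] coordinatewise convergence is uniform, so some [u m] is within [d] of the
     limit there; the Cauchy bound handles [u m - u n]. *)
  have [m Nm mP] : exists2 m, (N <= m)%N &
      \sum_(x <- A) normc (f x - u m x) <= d.
    have k0 : 0 < d / (#|` A|.+1)%:R by rewrite divr_gt0.
    have /choice [g gP] x := fP x _ k0.
    exists (maxn N (\max_(x <- A) g x)); first exact: leq_maxl.
    apply: (@le_trans _ _ (\sum_(x <- A) d / (#|` A|.+1)%:R)).
      rewrite big_seq [leRHS]big_seq; apply: ler_sum => x xA; apply/ltW/gP.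
      by apply: leq_trans (leq_maxr _ _); exact: leq_bigmax_seq.
    rewrite big_const_seq count_predT iter_addr_0 -[leLHS]mulr_natr -mulrA.
    by rewrite ler_piMr ?(ltW d0)// ler_pdivrMl// mulr1 ler_nat.
  rewrite (_ : fin_comb _ _ = fin_comb A (l2_fun (u m - u n))
      + fin_comb A (fun x => f x - u m x)); last first.
    rewrite /fin_comb -big_split; apply: eq_bigr => x _ /=.
    rewrite -scalerDl; congr (_ *: _).
    by change (f x - u n x = (u m x - u n x) + (f x - u m x)); ring.
  apply: le_trans (l2normD _ _) _; apply: lerD.
    exact: le_trans (l2norm_trunc_le _ _) (ltW (HN _ _ Nm Nn)).
  exact: le_trans (l2norm_fin_comb_le _ _) mP.
have mem n e : 0 < e -> (forall A, l2norm (fin_comb A (fun x => f x - u n x)) <= e) ->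
    (sqsum (fun x => (f x - u n x)%R) <= (e ^+ 2)%:E)%E.
  move=> e0 h; apply: l2_pred_fin => A; rewrite -l2norm_fin_comb.
  by rewrite ler_sqr ?nnegrE ?l2norm_ge0// ltW.
have [N0 HN0] := Hu _ ltr01.
have g2 : l2_pred R X (fun x => f x - u N0 x).
  have h := mem _ _ ltr01 (fun A => key _ _ ltr01 HN0 N0 A (leqnn _)).
  exact: le_lt_trans h (ltry _).
(* Only the difference from a term of the sequence is directly seen to be square summable; adding
   the term back gives the limit. *)
pose w := (L2 g2 : H) + u N0.
have wE x : w x = f x by rewrite l2DE /= subrK.
exists w => e e0; have [N HN] := Hu _ e0; exists N => n Nn.
rewrite -ler_sqr ?nnegrE ?l2norm_ge0 ?(ltW e0)// -lee_fin l2norm_sqr.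
rewrite (_ : sqsum _ = sqsum (fun x => f x - u n x)).
  by apply: mem => // A; exact: key HN _ _ Nn.
by congr sqsum; apply/funext => x; rewrite l2DE l2NE wE.
Qed.

End Truncation.

(** * Bounded operators, adjoints and diagonal operators *)

Section BoundedOps.
Variable R : realType.
Local Notation C := R[i].
Local Notation l2 := (l2 R).
Implicit Types X Y Z : choiceType.

Section Linear.
Variables (X Y : choiceType).
Implicit Types (a b : l2 X -> l2 Y) (c : C) (xi eta : l2 X).

Lemma bopP a : bounded_op R X Y a ->
  exists2 M : R, 0 <= M & forall xi, l2norm (a xi) <= M * l2norm xi.
Proof.
move=> [_ [M MP]]; exists `|M| => // xi; apply: le_trans (MP xi) _.
by rewrite ler_wpM2r ?l2norm_ge0 ?ler_norm.
Qed.

Lemma bopPZ a c xi eta : bounded_op R X Y a -> a (c *: xi + eta) = c *: a xi + a eta.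
Proof. by move=> [l _]; exact: l. Qed.
Lemma bop0 a : bounded_op R X Y a -> a 0 = 0.
Proof.
by move=> ba; have := bopPZ (-1) 0 0 ba; rewrite scaler0 addr0 scaleN1r addNr.
Qed.
Lemma bopD a xi eta : bounded_op R X Y a -> a (xi + eta) = a xi + a eta.
Proof. by move=> ba; rewrite -[xi]scale1r bopPZ// !scale1r. Qed.
Lemma bopZ a c xi : bounded_op R X Y a -> a (c *: xi) = c *: a xi.
Proof. by move=> ba; rewrite -[c *: xi]addr0 bopPZ// bop0// addr0. Qed.
Lemma bopB a xi eta : bounded_op R X Y a -> a (xi - eta) = a xi - a eta.
Proof. by move=> ba; rewrite bopD// -scaleN1r bopZ// scaleN1r. Qed.
Lemma bop_sum a (I : Type) (s : seq I) (P : pred I) (f : I -> l2 X) :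
  bounded_op R X Y a -> a (\sum_(i <- s | P i) f i) = \sum_(i <- s | P i) a (f i).
Proof.
move=> ba; elim/big_rec2: _ => [|i v w _ <-]; first exact: bop0.
by rewrite bopD.
Qed.

Lemma bop_lin a b c : bounded_op R X Y a -> bounded_op R X Y b ->
  bounded_op R X Y (c *: a + b).
Proof.
move=> ba bb; split.
  move=> d xi eta; rewrite /= !fctE /= !bopPZ//.
  by rewrite !scalerDr !scalerA mulrC -!addrA; congr (_ + _); rewrite addrCA.
have [M M0 MP] := bopP ba; have [N N0 NP] := bopP bb.
exists (normc c * M + N) => xi; rewrite /= !fctE; apply: le_trans (l2normD _ _) _.
rewrite l2normZ mulrDl lerD ?NP// -mulrA ler_wpM2l ?normc_ge0//.
Qed.

Lemma bop_zero : bounded_op R X Y 0.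
Proof.
split; first by move=> c xi eta; rewrite scaler0 addr0.
by exists 0 => xi; rewrite l2norm0 mul0r.
Qed.

Lemma bop_scale a c : bounded_op R X Y a -> bounded_op R X Y (c *: a).
Proof. by move=> ba; rewrite -[c *: a]addr0; apply: bop_lin ba bop_zero. Qed.
Lemma bop_add a b : bounded_op R X Y a -> bounded_op R X Y b ->
  bounded_op R X Y (a + b).
Proof. by move=> ba bb; rewrite -[a]scale1r; apply: bop_lin. Qed.
Lemma bop_opp a : bounded_op R X Y a -> bounded_op R X Y (- a).
Proof. by rewrite -scaleN1r; exact: bop_scale. Qed.
Lemma bop_sub a b : bounded_op R X Y a -> bounded_op R X Y b ->
  bounded_op R X Y (a - b).
Proof. by move=> ba bb; apply: bop_add => //; exact: bop_opp. Qed.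

Lemma opnorm_le a (M : R) : 0 <= M -> (forall xi, l2norm (a xi) <= M * l2norm xi) ->
  opnorm a <= M.
Proof.
move=> M0 h; apply: ge_sup; first by exists (l2norm (a 0)), 0 => //=; rewrite l2norm0.
move=> _ [xi /= x1 <-]; apply: le_trans (h _) _.
by rewrite ler_piMr.
Qed.

Lemma le_opnorm a xi : bounded_op R X Y a -> l2norm (a xi) <= opnorm a * l2norm xi.
Proof.
move=> ba; have [M M0 MP] := bopP ba.
have [->|x0] := eqVneq xi 0; first by rewrite bop0// !l2norm0 mulr0.
have n0 := l2norm_gt0 x0.
have ub : has_ubound [set l2norm (a xi) | xi in [set xi | l2norm xi <= 1]].
  by exists M => _ [eta /= e1 <-]; apply: le_trans (MP _) _; rewrite ler_piMr.
rewrite -ler_pdivrMr//; apply: (ub_le_sup ub).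
have nV : normc ((l2norm xi)^-1)%:C%C = (l2norm xi)^-1.
  by rewrite normc_real ger0_norm// invr_ge0 ltW.
exists (((l2norm xi)^-1)%:C%C *: xi) => /=.
  by rewrite l2normZ nV mulVf// gt_eqF.
by rewrite bopZ// l2normZ nV mulrC.
Qed.

Lemma op_ext a b : bounded_op R X Y a -> bounded_op R X Y b ->
  (forall x, a (delta R x) = b (delta R x)) -> a = b.
Proof.
move=> ba bb ab; have bc := bop_sub ba bb.
have [M M0 MP] := bopP bc.
apply/funext => xi; apply: dot_inj => zeta.
apply/eqP; rewrite -subr_eq0 -dotBl; apply/eqP.
apply: (@functional_ext _ _ (fun xi => '[(a - b) xi, zeta]) (M * l2norm zeta)).
- by move=> c x y; rewrite bopPZ// dotDl dotZl.
- move=> x; apply: le_trans (normc_dot_le _ _) _.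
  by rewrite mulrAC ler_wpM2r ?l2norm_ge0.
- by move=> x; rewrite fctE ab subrr dot0l.
Qed.

Lemma op_ext_dot a b : bounded_op R X Y a -> bounded_op R X Y b ->
  (forall x y, '[a (delta R x), delta R y] = '[b (delta R x), delta R y]) -> a = b.
Proof.
move=> ba bb ab; apply: op_ext => // x; apply: l2P => y.
by rewrite -!dot_deltar.
Qed.

(** The coordinates [f x] of the adjoint vector are forced by testing on [delta R x]. Square
    summability comes from testing on the truncations of [f] itself; equality on all vectors then
    follows by density. *)
Lemma adjoint_exists a : bounded_op R X Y a ->
  exists b : l2 Y -> l2 X, forall xi (eta : l2 Y), '[a xi, eta] = '[xi, b eta].
Proof.
move=> ba; have [M M0 MP] := bopP ba.
suff /choice [b bP] (eta : l2 Y) : exists beta : l2 X, forall xi, '[a xi, eta] = '[xi, beta].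
  by exists b => xi eta.
pose f x := '[a (delta R x), eta]^*.
have fP (A : {fset X}) : \sum_(x <- A) normc (f x) ^+ 2 <= (M * l2norm eta) ^+ 2.
  have e : '[a (fin_comb A f), eta] = (l2norm (fin_comb A f) ^+ 2)%:C%C.
    rewrite bop_sum// dot_suml l2norm_fin_comb rmorph_sum; apply: eq_bigr => x _ /=.
    by rewrite bopZ// dotZl -mulJc; congr (_ * _); rewrite conjCK.
  have := normc_dot_le (a (fin_comb A f)) eta.
  rewrite e normc_real ger0_norm ?sqr_ge0// => h.
  rewrite -l2norm_fin_comb ler_sqr ?nnegrE ?mulr_ge0 ?l2norm_ge0//.
  have [z|p] := eqVneq (l2norm (fin_comb A f)) 0.
    by rewrite z mulr_ge0 ?l2norm_ge0.
  have {}p : 0 < l2norm (fin_comb A f) by rewrite lt_neqAle eq_sym p l2norm_ge0.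
  rewrite -(ler_pM2r p) -expr2; apply: le_trans h _.
  by rewrite mulrAC ler_wpM2r ?l2norm_ge0.
have f2 : l2_pred R X f by exact: le_lt_trans (l2_pred_fin fP) (ltry _).
exists (L2 f2) => xi; apply/eqP; rewrite -subr_eq0; apply/eqP.
apply: (@functional_ext _ _ (fun xi => '[a xi, eta] - '[xi, L2 f2])
  (M * l2norm eta + l2norm (L2 f2))).
- move=> c x y; rewrite bopPZ// !dotDl !dotZl mulrBr; ring.
- move=> x; apply: le_trans (le_normcD _ _) _; rewrite normcN mulrDl lerD//.
    apply: le_trans (normc_dot_le _ _) _.
    by rewrite mulrAC ler_wpM2r ?l2norm_ge0.
  by apply: le_trans (normc_dot_le _ _) _; rewrite mulrC.
- by move=> x; rewrite dot_deltal /= /f conjCK subrr.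
Qed.

Lemma adjointP a xi (eta : l2 Y) : bounded_op R X Y a -> '[a xi, eta] = '[xi, adjoint a eta].
Proof. by move=> /adjoint_exists h; exact: (xgetPex _ h). Qed.

End Linear.

Section Adjoint.
Variables (X Y : choiceType).
Implicit Types (a b : l2 X -> l2 Y) (c : C).

Lemma adjoint_uniq a (b : l2 Y -> l2 X) :
  (forall xi eta, '[a xi, eta] = '[xi, b eta]) -> adjoint a = b.
Proof.
move=> h; have aP : [set b | forall xi eta, '[a xi, eta] = '[xi, b eta]] (adjoint a).
  by apply: xgetPex; exists b.
by apply/funext => eta; apply: dot_injr => zeta; rewrite -h aP.
Qed.

Lemma l2norm_adjoint a (M : R) : bounded_op R X Y a -> 0 <= M ->
  (forall xi, l2norm (a xi) <= M * l2norm xi) ->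
  forall eta, l2norm (adjoint a eta) <= M * l2norm eta.
Proof.
move=> ba M0 MP eta; apply: l2norm_le_dot => [|zeta]; first by rewrite mulr_ge0 ?l2norm_ge0.
rewrite dotC normcJr -adjointP//; apply: le_trans (normc_dot_le _ _) _.
by rewrite mulrAC ler_wpM2r ?l2norm_ge0.
Qed.

Lemma bop_adjoint a : bounded_op R X Y a -> bounded_op R Y X (adjoint a).
Proof.
move=> ba; have [M M0 MP] := bopP ba; split.
  move=> c xi eta; apply: dot_injr => zeta.
  by rewrite -adjointP// !dotDr !dotZr -!adjointP.
by exists M => eta; exact: l2norm_adjoint.
Qed.

Lemma adjointPl a xi eta : bounded_op R X Y a -> '[adjoint a xi, eta] = '[xi, a eta].
Proof. by move=> ba; rewrite dotC -adjointP// -dotC. Qed.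

Lemma adjoint_lin a b c : bounded_op R X Y a -> bounded_op R X Y b ->
  adjoint (c *: a + b) = c^* *: adjoint a + adjoint b.
Proof.
move=> ba bb; apply: adjoint_uniq => xi eta; rewrite !fctE.
by rewrite dotDl dotZl dotDr dotZr conjCK -!adjointP.
Qed.
End Adjoint.

Lemma adjointK X Y (a : l2 X -> l2 Y) : bounded_op R X Y a -> adjoint (adjoint a) = a.
Proof. by move=> ba; apply: adjoint_uniq => xi eta; rewrite adjointPl. Qed.

Lemma bop_comp X Y Z (a : l2 Y -> l2 Z) (b : l2 X -> l2 Y) :
  bounded_op R Y Z a -> bounded_op R X Y b -> bounded_op R X Z (a \o b).
Proof.
move=> ba bb; split=> [c xi eta|]; first by rewrite /= !bopPZ.
have [M M0 MP] := bopP ba; have [N N0 NP] := bopP bb.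
exists (M * N) => xi; apply: le_trans (MP _) _.
by rewrite -mulrA ler_wpM2l.
Qed.

Lemma adjoint_comp X Y Z (a : l2 Y -> l2 Z) (b : l2 X -> l2 Y) :
  bounded_op R Y Z a -> bounded_op R X Y b ->
  adjoint (a \o b) = adjoint b \o adjoint a.
Proof.
by move=> ba bb; apply: adjoint_uniq => xi eta /=; rewrite -!adjointP.
Qed.

Lemma adjoint_id X : adjoint (id : l2 X -> l2 X) = id.
Proof. exact: adjoint_uniq. Qed.

Lemma opnormB_le X Y (a b : l2 X -> l2 Y) xi : bounded_op R X Y a -> bounded_op R X Y b ->
  l2norm (a xi - b xi) <= opnorm (a - b) * l2norm xi.
Proof. by move=> ba bb; apply: (@le_opnorm _ _ (a - b) xi); exact: bop_sub. Qed.

Section Diagonal.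
Variable X : choiceType.
Implicit Types (f g : X -> C) (c : C).

Definition bddf f := exists M : R, forall x, normc (f x) <= M.

(** The multiplication operator by [f]. If the product is not square summable the value is the junk
    0, hence the [bddf] hypotheses. *)
Definition dg f : l2 X -> l2 X :=
  fun xi => insubd (0 : l2 X) (fun x => f x * xi x).

Lemma sqsum_mul f (M : R) (xi : l2 X) : (forall x, normc (f x) <= M) ->
  (sqsum (fun x => f x * xi x)%R <= ((M * l2norm xi) ^+ 2)%:E)%E.
Proof.
move=> fM; apply: l2_pred_fin => A.
apply: (@le_trans _ _ (M ^+ 2 * \sum_(x <- A) normc (xi x) ^+ 2)).
  rewrite mulr_sumr; apply: ler_sum => x _; rewrite normcM exprMn.
  rewrite ler_wpM2r ?sqr_ge0// ler_sqr ?nnegrE ?normc_ge0//.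
  by apply: le_trans (fM x); exact: normc_ge0.
by rewrite exprMn ler_wpM2l ?sqr_ge0// l2norm_fin_le.
Qed.

Lemma dgE f xi x : bddf f -> dg f xi x = f x * xi x.
Proof.
move=> [M fM]; rewrite /dg.
have fxi : l2_pred R X (fun x => f x * xi x).
  exact: le_lt_trans (sqsum_mul xi fM) (ltry _).
by have := insubdK (0 : l2 X) fxi => /(congr1 (fun h => h x)).
Qed.

Lemma dg_le f (M : R) xi : 0 <= M -> (forall x, normc (f x) <= M) ->
  l2norm (dg f xi) <= M * l2norm xi.
Proof.
move=> M0 fM; rewrite -ler_sqr ?nnegrE ?mulr_ge0 ?l2norm_ge0//.
rewrite -lee_fin l2norm_sqr (_ : sqsum _ = sqsum (fun x => f x * xi x)%R).
  exact: sqsum_mul.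
by congr sqsum; apply/funext => x; rewrite dgE//; exists M.
Qed.

Lemma bop_dg f : bddf f -> bounded_op R X X (dg f).
Proof.
move=> bf; split.
  move=> c xi eta; apply: l2P => x; rewrite !(dgE, l2DE, l2ZE)//.
  by rewrite mulrDr mulrCA.
have [M fM] := bf; exists `|M| => xi; apply: dg_le => // x.
exact: le_trans (fM x) (ler_norm _).
Qed.

Lemma bf_lin c f g : bddf f -> bddf g -> bddf (c *: f + g).
Proof.
move=> [M fM] [N gN]; exists (normc c * M + N) => x.
apply: le_trans (le_normcD _ _) _; rewrite normcM lerD//.
by rewrite ler_wpM2l ?normc_ge0.
Qed.

Lemma bf_mul f g : bddf f -> bddf g -> bddf (f * g).
Proof.
move=> [M fM] [N gN]; exists (`|M| * N) => x.
rewrite normcM ler_pM ?normc_ge0//; exact: le_trans (fM x) (ler_norm _).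
Qed.

Lemma bf_conj f : bddf f -> bddf (fun x => (f x)^*).
Proof. by move=> [M fM]; exists M => x; rewrite normcJr. Qed.

Lemma bf_indic A : bddf \1_A.
Proof.
by exists 1 => x; rewrite indicE; case: (_ \in _); rewrite ?normc0 ?normc1.
Qed.

Lemma dg_lin c f g : bddf f -> bddf g ->
  dg (c *: f + g) = c *: dg f + dg g.
Proof.
move=> bf bg; apply/funext => xi; apply: l2P => x.
rewrite dgE; last exact: bf_lin.
by rewrite !fctE l2DE l2ZE !dgE// mulrDl mulrA.
Qed.

Lemma dg_mul f g : bddf f -> bddf g -> dg (f * g) = dg f \o dg g.
Proof.
move=> bf bg; apply/funext => xi; apply: l2P => x.
by rewrite dgE; [rewrite /= !dgE// mulrA|exact: bf_mul].
Qed.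

Lemma dg_delta f x : bddf f -> dg f (delta R x) = f x *: delta R x.
Proof.
move=> bf; apply: l2P => z; rewrite dgE// l2ZE deltaE.
by case: eqP => [->|]; rewrite ?mulr0.
Qed.

Lemma adjoint_dg f : bddf f -> adjoint (dg f) = dg (fun x => (f x)^*).
Proof.
move=> bf; have bg := bf_conj bf.
apply: op_ext_dot; [exact/bop_adjoint/bop_dg|exact: bop_dg|].
move=> x y; rewrite adjointPl; last exact: bop_dg.
rewrite !dg_delta// dotZr dotZl !dot_deltar !deltaE.
by case: eqP => [->//|]; rewrite !mulr0.
Qed.

Lemma dg1 : dg (fun=> 1) = id.
Proof.
have b1 : bddf (fun=> 1) by exists 1 => x; rewrite normc1.
by apply/funext => xi; apply: l2P => x; rewrite dgE// mul1r.
Qed.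

Lemma linfty_dg f : bddf f -> linfty R X (dg f).
Proof.
move=> bf; split; first exact: bop_dg.
move=> [x y] /=; rewrite /supp /= dg_delta// dotZl dot_deltar deltaE.
by have [->//|xy] := eqVneq x y; rewrite mulr0 eqxx.
Qed.

Lemma linftyP a : linfty R X a -> exists2 f, bddf f & a = dg f.
Proof.
move=> [ba sa]; pose f x := '[a (delta R x), delta R x].
have bf : bddf f.
  have [M M0 MP] := bopP ba; exists M => x.
  apply: le_trans (normc_dot_le _ _) _; rewrite l2norm_delta mulr1.
  by apply: le_trans (MP _) _; rewrite l2norm_delta mulr1.
exists f => //; apply: op_ext_dot => //; first exact: bop_dg.
move=> x y; rewrite dg_delta// dotZl (dot_deltar (delta R x)) deltaE.
have [->|yx] := eqVneq y x; first by rewrite mulr1.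
rewrite mulr0; apply/eqP/negPn/negP => h.
by have := sa (y, x) h; rewrite /diagonal/= => /eqP; rewrite (negbTE yx).
Qed.

End Diagonal.
End BoundedOps.

(** * Rank-one operators *)

Section RankOne.
Variables (R : realType) (X : choiceType).
Local Notation C := R[i].
Local Notation H := (l2 R X).
Implicit Types (a b : H -> H) (xi eta v w : H) (c : C).

Definition rank1 w v : H -> H := fun xi => '[xi, v] *: w.

Lemma rank1_le w v xi : l2norm (rank1 w v xi) <= l2norm w * l2norm v * l2norm xi.
Proof.
rewrite l2normZ mulrC -mulrA ler_wpM2l ?l2norm_ge0// mulrC; exact: normc_dot_le.
Qed.

Lemma bop_rank1 w v : bounded_op R X X (rank1 w v).
Proof.
split; last by exists (l2norm w * l2norm v) => xi; exact: rank1_le.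
by move=> c xi eta; rewrite /rank1 dotDl dotZl scalerDl scalerA.
Qed.

Lemma adjoint_rank1 w v : adjoint (rank1 w v) = rank1 v w.
Proof.
apply: adjoint_uniq => xi eta; rewrite /rank1 dotZl dotZr -(dotC w eta).
by rewrite mulrC.
Qed.

Lemma comp_rank1 a w v : bounded_op R X X a -> a \o rank1 w v = rank1 (a w) v.
Proof. by move=> ba; apply/funext => xi; rewrite /= /rank1 bopZ. Qed.

Lemma rank1_comp a w v : bounded_op R X X a -> rank1 w v \o a = rank1 w (adjoint a v).
Proof. by move=> ba; apply/funext => xi; rewrite /= /rank1 adjointP. Qed.

Lemma rank1_sub_le w v w' v' xi :
  l2norm (rank1 w v xi - rank1 w' v' xi) <=
  (l2norm (w - w') * l2norm v + l2norm w' * l2norm (v - v')) * l2norm xi.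
Proof.
have -> : rank1 w v xi - rank1 w' v' xi = rank1 (w - w') v xi + rank1 w' (v - v') xi.
  by rewrite /rank1 dotBr scalerBr scalerBl addrA subrK.
by apply: le_trans (l2normD _ _) _; rewrite mulrDl lerD ?rank1_le.
Qed.

End RankOne.

(** * The uniform Roe algebra as a C*-algebra *)

Section Roe.
Variables (R : realType) (X : choiceType) (E : set (set (X * X))).
Hypothesis hE : coarse_space E.
Local Notation C := R[i].
Local Notation H := (l2 R X).
Local Notation roe := (uniform_roe R E).
Implicit Types (a b : H -> H) (xi eta v w : H) (c : C).

Lemma dot_neq0 xi eta : '[xi, eta] != 0 -> exists2 z, xi z != 0 & eta z != 0.
Proof.
apply: contraNP => /forall2NP h.
apply/eqP; apply: sumto_unique (@dot_sumto _ _ xi eta) _.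
apply/sumtoP => e e0; exists fset0 => B _; rewrite big1 ?subrr ?normc0// => z _.
have [/negP|/negP] := h z; rewrite negbK => /eqP ->; first by rewrite mul0r.
by rewrite rmorph0 mulr0.
Qed.

Lemma supp_lin c a b : supp (c *: a + b) `<=` supp a `|` supp b.
Proof.
move=> p; rewrite /supp /= !fctE dotDl dotZl.
have [->|?] := eqVneq '[a (delta R p.2), delta R p.1] 0; last by left.
by rewrite mulr0 add0r; right.
Qed.

Lemma supp_comp a b : bounded_op R X X a -> bounded_op R X X b ->
  supp (a \o b) `<=` [set p | exists z, supp a (p.1, z) /\ supp b (z, p.2)].
Proof.
move=> ba bb p; rewrite {1}/supp /= adjointP// => /dot_neq0 [z bz az].
exists z; split; rewrite /supp /= ?dot_deltar//.
by move: az; rewrite -dot_deltar adjointPl// dot_deltal conjC_eq0.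
Qed.

Lemma supp_adjoint a : bounded_op R X X a ->
  supp (adjoint a) `<=` [set p | supp a (p.2, p.1)].
Proof.
move=> ba p; rewrite /supp /= adjointPl// dotC conjC_eq0//.
Qed.

(** Trades the supremum in [opnorm] for estimates on single vectors; halving [e] recovers the strict
    inequality. *)
Lemma roeP a : roe a <-> bounded_op R X X a /\ forall e : R, 0 < e ->
  exists b, [/\ bounded_op R X X b, E (supp b) &
    forall xi, l2norm (a xi - b xi) <= e * l2norm xi].
Proof.
split=> -[ba ha]; split=> // e e0.
  have [b [bb Eb /ltW ab]] := ha _ e0; exists b; split=> // xi.
  by apply: le_trans (opnormB_le _ _ _) _; rewrite ?ler_wpM2r ?l2norm_ge0.
have [b [bb Eb ab]] := ha (e / 2) (divr_gt0 e0 (ltr0Sn R 1)).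
exists b; split=> //; apply: le_lt_trans (_ : e / 2 < e).
  by apply: opnorm_le => //; rewrite divr_ge0 ?ltW.
by rewrite ltr_pdivrMr// ltr_pMr// ltr1n.
Qed.

Lemma roe_bop a : roe a -> bounded_op R X X a. Proof. by case. Qed.

Lemma roe_supp a : bounded_op R X X a -> E (supp a) -> roe a.
Proof.
move=> ba Ea; apply/roeP; split=> // e e0; exists a; split=> // xi.
by rewrite subrr l2norm0 mulr_ge0 ?l2norm_ge0// ltW.
Qed.

Lemma roe_closed a : bounded_op R X X a ->
  (forall e : R, 0 < e -> exists2 b, roe b &
    forall xi, l2norm (a xi - b xi) <= e * l2norm xi) -> roe a.
Proof.
move=> ba h; apply/roeP; split=> // e e0.
have e2 : 0 < e / 2 by rewrite divr_gt0.
have [b /roeP[bb hb] ab] := h _ e2; have [b' [bb' Eb' b'P]] := hb _ e2.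
exists b'; split=> // xi; rewrite -(subrKA (b xi)) (splitr e) mulrDl.
by apply: le_trans (l2normD _ _) _; rewrite lerD.
Qed.

Lemma roe_lin c a b : roe a -> roe b -> roe (c *: a + b).
Proof.
move=> /roeP[ba ha] /roeP[bb hb]; apply/roeP; split; first exact: bop_lin.
move=> e e0; have e2 : 0 < e / 2 by rewrite divr_gt0.
have c1 : 0 < normc c + 1 by rewrite ltr_wpDl// normc_ge0.
have [a' [ba' Ea' a'P]] := ha _ (divr_gt0 e2 c1).
have [b' [bb' Eb' b'P]] := hb _ e2.
exists (c *: a' + b'); split; first exact: bop_lin.
  by apply: (coarse_sub hE (@supp_lin c a' b')); exact: (coarse_union hE).
move=> xi; rewrite !fctE opprD addrACA -scalerBr (splitr e) mulrDl.
apply: le_trans (l2normD _ _) _; rewrite lerD// l2normZ.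
apply: le_trans (_ : (normc c + 1) * (e / 2 / (normc c + 1) * l2norm xi) <= _).
  apply: ler_pM; rewrite ?normc_ge0 ?l2norm_ge0//.
  by rewrite lerDl.
by rewrite mulrA mulrCA divff ?mulr1// gt_eqF.
Qed.

Lemma roe_comp a b : roe a -> roe b -> roe (a \o b).
Proof.
move=> /roeP[ba ha] /roeP[bb hb]; apply/roeP; split; first exact: bop_comp.
move=> e e0; have e2 : 0 < e / 2 by rewrite divr_gt0.
have [N N0 NP] := bopP bb.
have N1 : 0 < N + 1 by rewrite ltr_wpDl.
have [a' [ba' Ea' a'P]] := ha _ (divr_gt0 e2 N1).
have [M M0 MP] := bopP ba'.
have M1 : 0 < M + 1 by rewrite ltr_wpDl.
have [b' [bb' Eb' b'P]] := hb _ (divr_gt0 e2 M1).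
exists (a' \o b'); split; first exact: bop_comp.
  by apply: (coarse_sub hE (supp_comp ba' bb')); exact: (coarse_comp hE).
move=> xi /=; rewrite -(subrKA (a' (b xi))) (splitr e) mulrDl.
apply: le_trans (l2normD _ _) _; rewrite lerD//.
  apply: le_trans (a'P _) _; rewrite -mulrA ler_wpM2l ?(ltW e2)//.
  rewrite ler_pdivrMl//; apply: le_trans (NP _) _.
  by rewrite ler_wpM2r ?l2norm_ge0// lerDl.
rewrite -bopB//; apply: le_trans (MP _) _.
apply: le_trans (_ : (M + 1) * (e / 2 / (M + 1) * l2norm xi) <= _).
  by apply: ler_pM; rewrite ?l2norm_ge0// lerDl.
by rewrite mulrA mulrCA divff ?mulr1// gt_eqF.
Qed.

Lemma roe_adjoint a : roe a -> roe (adjoint a).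
Proof.
move=> /roeP[ba ha]; apply/roeP; split; first exact: bop_adjoint.
move=> e e0; have [b [bb Eb bP]] := ha _ e0.
exists (adjoint b); split; first exact: bop_adjoint.
  by apply: (coarse_sub hE (supp_adjoint bb)); exact: (coarse_inv hE).
have bab := bop_sub ba bb.
move=> xi; have := l2norm_adjoint bab (ltW e0) bP xi.
rewrite (_ : a - b = (-1) *: b + a); last by rewrite scaleN1r addrC.
by rewrite adjoint_lin// rmorphN rmorph1 scaleN1r !fctE addrC.
Qed.

Lemma roe_linfty a : linfty R X a -> roe a.
Proof.
by move=> [ba sa]; apply: roe_supp => //; exact: (coarse_sub hE sa (coarse_diag hE)).
Qed.

Lemma roe_dg f : bddf f -> roe (dg f).
Proof. by move=> bf; exact/roe_linfty/linfty_dg. Qed.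

Lemma roe_id : roe id.
Proof. by rewrite -(dg1 R X); apply: roe_dg; exists 1 => x; rewrite normc1. Qed.

Lemma roe_zero : roe 0.
Proof.
have := roe_lin (-1) roe_id roe_id; rewrite scaleN1r.
by congr roe; rewrite addrC subrr.
Qed.

(** An approximant within half the modulus of the entry still has a nonzero entry there. Hence
    operators of the Roe algebra never connect different coarse components. *)
Lemma roe_entry a x y : roe a -> '[a (delta R y), delta R x] != 0 -> E [set (x, y)].
Proof.
move=> /roeP[ba ha] axy.
have e0 : 0 < normc '[a (delta R y), delta R x] / 2.
  rewrite divr_gt0// lt_neqAle normc_ge0 andbT eq_sym.
  by apply: contra axy => /eqP/eq0_normc ->.
have [b [bb Eb /(_ (delta R y))]] := ha _ e0.
rewrite l2norm_delta mulr1 => h.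
apply: (coarse_sub hE _ Eb) => _ ->; rewrite /supp /=.
apply/eqP => b0; have := le_trans (l2norm_ge _ x) h.
rewrite -dot_deltar dotBl b0 subr0 => k.
by move: e0; rewrite ltNge -(lerD2l (normc '[a (delta R y), delta R x] / 2)) addr0 -splitr k.
Qed.

Lemma roe_rank1 x y : E [set (x, y)] -> roe (rank1 (delta R x) (delta R y)).
Proof.
move=> Exy; apply: roe_supp; first exact: bop_rank1.
apply: (coarse_sub hE _ Exy) => -[x' y'].
rewrite /supp /= /rank1 dotZl !dot_deltar !deltaE mulf_eq0 negb_or.
by rewrite !pnatr_eq0 !eqb0 !negbK => /andP[/eqP -> /eqP ->].
Qed.

Hypothesis hEf : uniformly_locally_finite E.

(** Uniform local finiteness bounds the sections in the second variable, so it is applied to the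
    inverse of the support in order to bound columns. *)
Lemma roe_column_finite a (e : R) : roe a -> 0 < e -> exists b n,
  [/\ bounded_op R X X b, forall xi, l2norm (a xi - b xi) <= e * l2norm xi &
    forall y, exists2 T : {fset X}, (#|` T| <= n)%N &
      forall z, z \notin T -> b (delta R y) z = 0].
Proof.
move=> /roeP[ba ha] e0; have [b [bb Eb bP]] := ha _ e0.
have [n nP] := hEf (coarse_inv hE Eb).
exists b, n; split=> // y.
have fin : finite_set [set z | supp b (z, y)] .
  by apply/finite_set_leP; exists n; exact: nP.
exists (fset_set [set z | supp b (z, y)]).
  by apply: geq_card_fset_set; exact: nP.
move=> z; rewrite in_fset_set// notin_setE /supp /= => /negP.
by rewrite negbK dot_deltar => /eqP.
Qed.

End Roe.

(** * Unitaries from orthonormal bases *)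

Section Unitary.
Variables (R : realType) (X Y : choiceType).
Local Notation C := R[i].

Lemma unitaryP (u : l2 R X -> l2 R Y) : unitary u ->
  [/\ bounded_op R X Y u, cancel u (adjoint u) & cancel (adjoint u) u].
Proof.
by move=> [bu uu uu']; split=> // x;
  [move/(congr1 (@^~ x)): uu|move/(congr1 (@^~ x)): uu'].
Qed.

Lemma dot_unitary (u : l2 R X -> l2 R Y) xi eta : unitary u ->
  '[u xi, u eta] = '[xi, eta].
Proof. by move=> /unitaryP[bu uK _]; rewrite adjointP// uK. Qed.

(** The unitary is the adjoint of the coefficient map [w], a contraction by Bessel's inequality.
    Orthonormality gives that [w] sends [e x] to [delta R x]; totality gives surjectivity. *)
Lemma orthonormal_basis_unitary (e : X -> l2 R Y) :
  (forall x z, '[e x, e z] = (x == z)%:R) ->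
  (forall v, (forall x, '[v, e x] = 0) -> v = 0) ->
  exists2 u, unitary u & forall x, u (delta R x) = e x.
Proof.
move=> orth tot.
have bessel v (A : {fset X}) :
    \sum_(x <- A) normc '[v, e x] ^+ 2 <= l2norm v ^+ 2.
  pose s := \sum_(x <- A) '[v, e x] *: e x.
  have vs : '[v, s] = (\sum_(x <- A) normc '[v, e x] ^+ 2)%:C%C.
    rewrite dot_sumr rmorph_sum; apply: eq_bigr => x _.
    by rewrite dotZr mulrC mulJc.
  have ss : '[s, s] = (\sum_(x <- A) normc '[v, e x] ^+ 2)%:C%C.
    rewrite {1}/s dot_suml rmorph_sum big_seq [RHS]big_seq; apply: eq_bigr => x xA.
    rewrite dotZl dot_sumr (big_fsetD1 x)// dotZr orth eqxx mulr1 big1_seq /=.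
      by rewrite addr0 mulJc.
    move=> z; rewrite in_fsetD1 dotZr orth eq_sym => /andP[/negbTE -> _].
    by rewrite mulr0.
  have o : '[v - s, s] = 0 by rewrite dotBl vs ss subrr.
  move: ss; rewrite dotxx => /complexI <-.
  have -> : l2norm v ^+ 2 = l2norm (v - s) ^+ 2 + l2norm s ^+ 2.
    by rewrite -pythagoras// subrK.
  by rewrite lerDr sqr_ge0.
have w2 v : l2_pred R X (fun x => '[v, e x]).
  exact: le_lt_trans (l2_pred_fin (bessel v)) (ltry _).
pose w v := L2 (w2 v).
have bw : bounded_op R Y X w.
  split; first by move=> c v v'; apply: l2P => x; rewrite /= dotDl dotZl.
  exists 1 => v; rewrite mul1r -ler_sqr ?nnegrE ?l2norm_ge0//.
  by rewrite -lee_fin l2norm_sqr; apply: l2_pred_fin => A; exact: bessel.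
have ue x : adjoint w (delta R x) = e x.
  by apply: dot_injr => v; rewrite -adjointP// dot_deltar.
have we x : w (e x) = delta R x by apply: l2P => z; rewrite /= orth eq_sym.
exists (adjoint w) => //; split; first exact: bop_adjoint.
  rewrite adjointK//; apply/funext => xi; apply: l2P => x /=.
  by rewrite -ue adjointPl// ue we dot_deltar.
rewrite adjointK//; apply/funext => v /=; apply/eqP; rewrite -subr_eq0.
by apply/eqP/tot => x; rewrite dotBl adjointPl// we dot_deltar /= subrr.
Qed.

End Unitary.

(** * Operators of rank one *)

Section Rank.
Variables (R : realType) (X : choiceType).
Local Notation C := R[i].
Implicit Types (P : l2 R X -> l2 R X).

Lemma has_rank1 (v : l2 R X) P : v != 0 -> range P = range (fun c : C => c *: v) ->
  has_rank 1 P.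
Proof.
move=> v0 rP; exists (fun=> v); split.
  move=> c; rewrite big_ord1 => /eqP; rewrite scaler_eq0 (negbTE v0) orbF => /eqP.
  by move=> c0 i; rewrite ord1.
rewrite rP; apply/seteqP; split=> [_ [c _ <-]|_ [c _ <-]].
  by exists (fun=> c) => //; rewrite big_ord1.
by exists (c ord0) => //; rewrite big_ord1.
Qed.

Lemma has_rank1P P : has_rank 1 P ->
  exists2 v : l2 R X, v != 0 & range P = range (fun c : C => c *: v).
Proof.
move=> [v [vi rP]]; exists (v ord0).
  apply/eqP => v0; have := vi (fun=> 1); rewrite big_ord1 v0 scaler0.
  by move=> /(_ erefl ord0)/eqP; rewrite oner_eq0.
rewrite rP; apply/seteqP; split=> [_ [c _ <-]|_ [c _ <-]].
  by exists (c ord0) => //; rewrite big_ord1.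
by exists (fun=> c) => //; rewrite big_ord1.
Qed.

Lemma rank1_projection P (v : l2 R X) : bounded_op R X X P -> adjoint P = P ->
  has_rank 1 P -> l2norm v = 1 -> P v = v -> P = rank1 v v.
Proof.
move=> bP aP /has_rank1P [w w0 rP] v1 Pv.
have [c _ cv] : range (fun c : C => c *: w) v by rewrite -rP; exists v.
have c0 : c != 0.
  apply/eqP => c0; move: cv; rewrite c0 scale0r => v0.
  by have := oner_neq0 R; rewrite -v1 -v0 l2norm0 eqxx.
apply/funext => xi; have [d _ dP] : range (fun c : C => c *: w) (P xi).
  by rewrite -rP; exists xi.
have e : P xi = (d / c) *: v by rewrite -dP -cv scalerA divfK.
have : '[P xi, v] = d / c by rewrite e dotZl dotxx v1 expr1n mulr1.
by rewrite adjointP// aP Pv e /rank1 => ->.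
Qed.

Lemma has_rank1_rank1 (v : l2 R X) : v != 0 -> has_rank 1 (rank1 v v).
Proof.
move=> v0; apply: (@has_rank1 v) => //; apply/seteqP; split=> [_ [xi _ <-]|_ [c _ <-]].
  by exists '[xi, v].
exists ((c / '[v, v]) *: v) => //; rewrite /rank1 dotZl divfK//.
by rewrite dotxx (inj_eq (@complexI R) _ 0) expf_eq0 gt_eqF// l2norm_gt0.
Qed.

End Rank.

(** * Embeddings: the projections [eproj] and the implementing unitary *)

Section Embedding.
Variables (R : realType) (X Y : choiceType).
Variables (E : set (set (X * X))) (F : set (set (Y * Y))).
Hypotheses (hE : coarse_space E) (hF : coarse_space F).
Variable Phi : (l2 R X -> l2 R X) -> l2 R Y -> l2 R Y.
Hypothesis hPhi : embedding (uniform_roe R E) (uniform_roe R F) Phi.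
Local Notation C := R[i].
Local Notation A := (uniform_roe R E).
Implicit Types (a b : l2 R X -> l2 R X) (S T : set X) (v w : l2 R Y) (c : C) (x y z : X).

Lemma emb_bop a : A a -> bounded_op R Y Y (Phi a).
Proof. by move=> /(emb_fun hPhi); exact: roe_bop. Qed.

Lemma emb0 : Phi 0 = 0.
Proof.
have := emb_linear hPhi (-1) (roe_zero R hE) (roe_zero R hE).
by rewrite scaleN1r oppr0 addr0 scaleN1r addNr.
Qed.

Lemma embZ c a : A a -> Phi (c *: a) = c *: Phi a.
Proof.
move=> Aa; have := emb_linear hPhi c Aa (roe_zero R hE).
by rewrite emb0 !addr0.
Qed.

Lemma emb_eq0 a : A a -> Phi a = 0 -> a = 0.
Proof.
move=> Aa; rewrite -emb0 => h.
exact: (emb_inj hPhi (mem_set Aa) (mem_set (roe_zero R hE)) h).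
Qed.

(** A finitely additive projection-valued measure on all subsets of X. Countable additivity would
    require some continuity of [Phi]. *)
Definition eproj S := Phi (dg \1_S).

Lemma roe_indic S : A (dg \1_S).
Proof. exact/roe_dg/bf_indic. Qed.

Lemma bop_eproj S : bounded_op R Y Y (eproj S).
Proof. exact/emb_bop/roe_indic. Qed.
#[local] Hint Resolve bop_eproj : core.

Lemma eprojM S T : eproj S \o eproj T = eproj (S `&` T).
Proof.
rewrite /eproj -(emb_mul hPhi); [|exact: roe_indic..].
by rewrite indicI -dg_mul//; exact: bf_indic.
Qed.

Lemma eprojE S T v : eproj S (eproj T v) = eproj (S `&` T) v.
Proof. by rewrite -eprojM. Qed.

Lemma adjoint_eproj S : adjoint (eproj S) = eproj S.
Proof.
rewrite -(emb_adjoint hPhi); last exact: roe_indic.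
rewrite adjoint_dg; last exact: bf_indic.
congr (Phi (dg _)); apply/funext => x; rewrite indicE.
by case: (_ \in _); rewrite ?rmorph0 ?rmorph1.
Qed.

Lemma dot_eproj S v w : '[eproj S v, w] = '[v, eproj S w].
Proof. by rewrite adjointP// adjoint_eproj. Qed.

Lemma eproj_set0 : eproj set0 = 0.
Proof.
rewrite /eproj indic0 (_ : dg _ = 0) ?emb0//.
apply/funext => xi; apply: l2P => x; rewrite dgE; first by rewrite mul0r.
by exists 0 => z; rewrite normc0.
Qed.

Lemma indic_set1 x z : (\1_[set x] z : C) = (z == x)%:R.
Proof.
rewrite indicE; congr ((nat_of_bool _)%:R).
by apply/idP/eqP => [/set_mem//|->]; exact: mem_set.
Qed.

Lemma dg_set1 x : dg \1_[set x] = rank1 (delta R x) (delta R x).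
Proof.
have b := bf_indic R [set x].
apply: op_ext; [exact: bop_dg|exact: bop_rank1|] => z.
rewrite dg_delta// /rank1 indic_set1 dot_deltar deltaE eq_sym.
by case: eqP => [->//|]; rewrite !scale0r.
Qed.

Lemma eprojU S T : S `&` T = set0 -> eproj (S `|` T) = eproj S + eproj T.
Proof.
move=> ST; rewrite /eproj -[Phi (dg \1_S)]scale1r -(emb_linear hPhi).
- congr Phi; rewrite -dg_lin; try exact: bf_indic.
  congr dg; apply/funext => x; rewrite !fctE scale1r !indicE in_setU.
  have := congr1 (fun D => x \in D) ST; rewrite /= in_setI in_set0.
  by case: (x \in S); case: (x \in T); rewrite ?addr0 ?add0r.
- exact: roe_indic.
- exact: roe_indic.
Qed.

Lemma eproj_le S v : l2norm (eproj S v) <= l2norm v.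
Proof.
have [->|p] := eqVneq (eproj S v) 0; first by rewrite l2norm0 l2norm_ge0.
rewrite -(ler_pM2l (l2norm_gt0 p)) -expr2.
have := normc_dot_le (eproj S v) v.
by rewrite -{1}[S]setIid -eprojE dot_eproj dotxx normc_real ger0_norm// sqr_ge0.
Qed.

Lemma eproj_subset S T v : S `<=` T -> l2norm (eproj S v) <= l2norm (eproj T v).
Proof. by move=> /setIidl ST; rewrite -ST -eprojE eproj_le. Qed.

Local Notation unit_entry x z := (rank1 (delta R x) (delta R z)).

Lemma unit_entryM x y z : unit_entry x y \o unit_entry y z = unit_entry x z.
Proof.
rewrite comp_rank1; last exact: bop_rank1.
by congr rank1; rewrite /rank1 dot_deltar deltaE eqxx scale1r.
Qed.

(** Matrix units between x and z lie in the Roe algebra exactly when x and z are in the same coarse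
    component. Phases are free from one component to another, because the entries of [a] between
    distinct components vanish. *)
Lemma implemented_by_unitary :
  (forall x, has_rank 1 (eproj [set x])) ->
  (forall v, (forall x, eproj [set x] v = 0) -> v = 0) ->
  exists2 u, unitary u & implemented_by A Phi u.
Proof.
move=> rk tot.
pose rel x z := E [set (x, z)].
have relxx x : rel x x by apply: coarse_sub (coarse_diag hE) => // _ ->.
have relC x z : rel x z -> rel z x.
  by move=> /(coarse_inv hE); apply: coarse_sub => // _ ->.
have relT y x z : rel x y -> rel y z -> rel x z.
  move=> xy yz; apply: coarse_sub (coarse_comp hE xy yz) => // _ -> /=.
  by exists y.
pose rep x := xget x [set z | rel x z].
have relrep x : rel x (rep x) := @xgetPex _ x [set z | rel x z] (ex_intro _ x (relxx x)).
have rep_eq x z : rel x z -> rep x = rep z.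
  move=> xz; rewrite /rep (_ : [set w | rel x w] = [set w | rel z w]).
    rewrite /xget; case: pselect => // -[]; exists z; exact/asboolP/relxx.
  by apply/seteqP; split=> w /=; apply: relT => //; exact: relC.
have Ae x z : rel x z -> A (unit_entry x z) by exact: roe_rank1.
have q x : eproj [set x] = Phi (unit_entry x x) by rewrite /eproj dg_set1.
have /choice [e0 e0P] x : exists v, l2norm v = 1 /\ eproj [set x] v = v.
  have [v v0 rP] := has_rank1P (rk x).
  have nv : normc ((l2norm v)^-1)%:C%C = (l2norm v)^-1.
    by rewrite normc_real ger0_norm// invr_ge0 l2norm_ge0.
  exists (((l2norm v)^-1)%:C%C *: v); split.
    by rewrite l2normZ nv mulVf// gt_eqF// l2norm_gt0.
  have [xi _ <-] : range (eproj [set x]) (((l2norm v)^-1)%:C%C *: v).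
    by rewrite rP; exists ((l2norm v)^-1)%:C%C.
  by rewrite eprojE setIid.
(* Only the phase at the representative is arbitrary. Transport by matrix units then gives
   [Phi (unit_entry x z) (e z) = e x] with no scalar factor. *)
pose e x := Phi (unit_entry x (rep x)) (e0 (rep x)).
have mulP x y z v : rel x y -> rel y z ->
    Phi (unit_entry x y) (Phi (unit_entry y z) v) = Phi (unit_entry x z) v.
  move=> xy yz; rewrite -(unit_entryM x y z) (emb_mul hPhi)//; exact: Ae.
have Pe x z : rel x z -> Phi (unit_entry x z) (e z) = e x.
  by move=> xz; rewrite /e (rep_eq _ _ xz) mulP//; exact: relrep.
have qe x : eproj [set x] (e x) = e x by rewrite q Pe.
have e1 x : l2norm (e x) = 1.
  have [n1 p1] := e0P (rep x).
  apply/eqP; rewrite -(@eqrXn2 _ 2) ?l2norm_ge0// expr1n; apply/eqP/complexI.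
  rewrite -dotxx {1}/e adjointP; last exact/emb_bop/Ae/relrep.
  rewrite -(emb_adjoint hPhi); last exact/Ae/relrep.
  rewrite adjoint_rank1 mulP; [|exact/relC/relrep|exact: relrep].
  by rewrite -q p1 dotxx n1 expr1n.
have orth x z : '[e x, e z] = (x == z)%:R.
  have [->|xz] := eqVneq x z; first by rewrite dotxx e1 expr1n.
  rewrite -qe -(qe z) dot_eproj eprojE (_ : _ `&` _ = set0).
    by rewrite eproj_set0 dot0r.
  by apply/seteqP; split=> // y [/= -> /eqP]; rewrite (negbTE xz).
have qE x : eproj [set x] = rank1 (e x) (e x).
  by apply: rank1_projection => //; rewrite adjoint_eproj.
have tot' v : (forall x, '[v, e x] = 0) -> v = 0.
  by move=> h; apply: tot => x; rewrite qE /rank1 h scale0r.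
have [u uu ue] := orthonormal_basis_unitary orth tot'.
have [bu uK u'K] := unitaryP uu.
exists u => // a Aa.
have ba := roe_bop Aa.
(* Inserting the projections at x and z replaces [a] by a scalar multiple of one matrix unit. If the
   scalar is nonzero, [roe_entry] puts x and z in one component, where [Pe] applies. *)
have entry x z : '[Phi a (e z), e x] = a (delta R z) x.
  rewrite -{1}(qe z) -{1}(qe x) -dot_eproj !q.
  have -> w : Phi (unit_entry x x) (Phi a (Phi (unit_entry z z) w)) =
      Phi (unit_entry x x \o (a \o unit_entry z z)) w.
    have [Axx Azz] : A (unit_entry x x) /\ A (unit_entry z z) by split; exact: Ae.
    by rewrite (emb_mul hPhi Axx (roe_comp hE Aa Azz)) (emb_mul hPhi Aa Azz).
  rewrite comp_rank1// comp_rank1; last exact: bop_rank1.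
  have -> : rank1 (unit_entry x x (a (delta R z))) (delta R z) =
      a (delta R z) x *: unit_entry x z.
    by apply/funext => xi; rewrite /rank1 !fctE !dot_deltar !scalerA mulrC.
  have [->|axz] := eqVneq (a (delta R z) x) 0.
    by rewrite scale0r emb0 dot0l.
  have xz : rel x z by apply: (roe_entry hE Aa); rewrite dot_deltar.
  rewrite (embZ _ (Ae _ _ xz)).
  change ('[a (delta R z) x *: Phi (unit_entry x z) (e z), e x] = a (delta R z) x).
  by rewrite dotZl (Pe _ _ xz) orth eqxx mulr1.
pose D := Phi a - (u \o a \o adjoint u).
have bD : bounded_op R Y Y D.
  apply: bop_sub; first exact: emb_bop.
  by apply: bop_comp; [exact: bop_comp|exact: bop_adjoint].
have De z : D (e z) = 0.
  apply: tot' => x; rewrite (_ : D _ = Phi a (e z) - u (a (adjoint u (e z))))//.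
  rewrite dotBl entry -(ue z) uK -(ue x) dot_unitary//.
  by rewrite dot_deltar subrr.
(* Totality is a statement on vectors orthogonal to all [e z], and [D (e z) = 0] makes the range of
   the adjoint orthogonal to them. *)
have D0 : adjoint D = 0.
  by apply/funext => v; apply: tot' => z; rewrite adjointPl// De dot0r.
have {}D0 : D = 0.
  apply/funext => v; apply: dot_inj => w; rewrite adjointP// D0.
  by rewrite dot0r dot0l.
by apply/eqP; rewrite -subr_eq0; apply/eqP.
Qed.

End Embedding.

Section L2Limits.
Variables (R : realType).

Lemma cvg_l2P (X : choiceType) (T : Type) (G : set_system T) (f : T -> l2 R X) xi :
  Filter G ->
  f @ G --> xi <-> (forall e : R, 0 < e -> \forall t \near G, l2norm (xi - f t) < e).
Proof.
move=> FG; split.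
  move=> /cvgrPdist_lt h e e0; have := h e%:C%C; rewrite ltcR => /(_ e0).
  by apply: filterS => t; rewrite l2_normE ltcR.
move=> h; apply/cvgrPdist_lt => _ /complex_lt_real [e e0 ->].
by apply: filterS (h _ e0) => t; rewrite l2_normE ltcR.
Qed.

Lemma bop_cvg (X Y : choiceType) (u : l2 R X -> l2 R Y) (T : Type)
    (G : set_system T) (f : T -> l2 R X) xi : Filter G ->
  bounded_op R X Y u -> f @ G --> xi -> u (f t) @[t --> G] --> u xi.
Proof.
move=> FG bu /cvg_l2P h; apply/cvg_l2P => e e0; have [M M0 MP] := bopP bu.
have M1 : 0 < M + 1 by rewrite ltr_wpDl.
apply: filterS (h _ (divr_gt0 e0 M1)) => t; rewrite ltr_pdivlMr// => k.
rewrite -bopB//; apply: le_lt_trans (MP _) _; apply: le_lt_trans k.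
by rewrite mulrC ler_wpM2l ?l2norm_ge0// lerDl.
Qed.

End L2Limits.

(** * From the unitary to the other conditions, and totality from strong continuity *)

Section Implications.
Variables (R : realType) (X Y : choiceType).
Variables (E : set (set (X * X))) (F : set (set (Y * Y))).
Hypotheses (hE : coarse_space E) (hF : coarse_space F).
Variable Phi : (l2 R X -> l2 R X) -> l2 R Y -> l2 R Y.
Hypothesis hPhi : embedding (uniform_roe R E) (uniform_roe R F) Phi.
Local Notation C := R[i].
Local Notation A := (uniform_roe R E).
Local Notation M := (Phi @` linfty R X).
Implicit Types (a b : l2 R X -> l2 R X) (v w : l2 R Y) (c : C) (x y z : X).

Lemma unitary_rank_preserving (u : l2 R X -> l2 R Y) :
  unitary u -> implemented_by A Phi u -> rank_preserving A Phi.
Proof.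
move=> uu iu n a Aa [v [vi ra]]; have [bu uK u'K] := unitaryP uu.
exists (fun i => u (v i)); split.
  move=> c c0; apply: vi.
  have e : u (\sum_i c i *: v i) = 0.
    by rewrite bop_sum// -[RHS]c0; apply: eq_bigr => i _; rewrite bopZ.
  by rewrite -[LHS]uK e bop0//; exact: bop_adjoint.
have rE (c : 'I_n -> C) : \sum_i c i *: u (v i) = u (\sum_i c i *: v i).
  by rewrite bop_sum//; apply: eq_bigr => i _; rewrite bopZ.
rewrite (iu _ Aa); apply/seteqP; split=> [_ [w _ <-]|_ [c _ <-]].
  have : range a (a (adjoint u w)) by exists (adjoint u w).
  by rewrite ra => -[c _ /= <-]; exists c.
have : [set \sum_i c i *: v i | c in setT] (\sum_i c i *: v i) by exists c.
by rewrite -ra => -[xi _ axi]; exists (u xi); rewrite //= uK axi rE.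
Qed.

Lemma unitary_strongly_continuous (u : l2 R X -> l2 R Y) :
  unitary u -> implemented_by A Phi u -> strongly_continuous A Phi.
Proof.
move=> uu iu; have [bu uK u'K] := unitaryP uu.
pose f a : l2 R Y -> l2 R Y := u \o a \o adjoint u.
apply: (@subspace_eq_continuous {ptws l2 R X -> l2 R X} A
   {ptws l2 R Y -> l2 R Y} f Phi) => [a|].
  by rewrite inE => Aa; rewrite (iu _ Aa).
apply: (@continuous_subspaceT {ptws l2 R X -> l2 R X} {ptws l2 R Y -> l2 R Y} A f).
move=> a.
have Fa : ProperFilter (nbhs (a : {ptws l2 R X -> l2 R X})) by apply: nbhs_pfilter.
have Ff : Filter (f @ nbhs (a : {ptws l2 R X -> l2 R X})) by apply: fmap_filter.
have H1 := @pointwise_cvgP (l2 R Y) (l2 R Y) (f @ nbhs (a : {ptws l2 R X -> l2 R X})) (f a) Ff.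
refine (H1.2 _) => v.
have H2 := @pointwise_cvgP (l2 R X) (l2 R X) (nbhs (a : {ptws l2 R X -> l2 R X})) a Fa.
have H3 : {ptws, nbhs (a : {ptws l2 R X -> l2 R X}) --> (a : l2 R X -> l2 R X)}.
  exact: cvg_id.
have H4 := H2.1 H3 (adjoint u v).
exact: (@bop_cvg _ _ _ u _ _ (fun b : {ptws l2 R X -> l2 R X} => b (adjoint u v)) _ Fa bu H4).
Qed.

(** The ambient [B] is left open because both masa conditions use this. *)
Lemma linfty_abelian_sa_subalg (B : set (l2 R Y -> l2 R Y)) :
  M `<=` B -> abelian_sa_subalg B M.
Proof.
have dgA f : bddf f -> A (dg f) by move=> bf; exact: roe_dg.
have dgM f : bddf f -> M (Phi (dg f)) by move=> bf; exists (dg f) => //; exact: linfty_dg.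
have MP (b : l2 R Y -> l2 R Y) : M b -> exists2 f, bddf f & b = Phi (dg f).
  by move=> [_ /linftyP [f bf ->] <-]; exists f.
move=> MB; split=> //.
- split=> [|c _ _ /MP[f bf ->] /MP[g bg ->]].
    by exists 0; [split; [exact: bop_zero|move=> p; rewrite /supp /= dot0l eqxx]|exact: emb0 hPhi].
  by rewrite -(emb_linear hPhi _ (dgA _ bf) (dgA _ bg)) -dg_lin//; apply/dgM/bf_lin.
- move=> _ _ /MP[f bf ->] /MP[g bg ->].
  by rewrite -(emb_mul hPhi (dgA _ bf) (dgA _ bg)) -dg_mul//; apply/dgM/bf_mul.
- move=> _ /MP[f bf ->]; rewrite -(emb_adjoint hPhi (dgA _ bf)) adjoint_dg//.
  exact/dgM/bf_conj.
- move=> _ _ /MP[f bf ->] /MP[g bg ->].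
  rewrite -(emb_mul hPhi (dgA _ bf) (dgA _ bg)) -(emb_mul hPhi (dgA _ bg) (dgA _ bf)).
  by rewrite -!dg_mul// mulrC.
Qed.

(** Pulled back by [u], an operator commuting with [M] commutes with the projections onto the basis
    vectors, so it is diagonal. *)
Lemma unitary_masa (u : l2 R X -> l2 R Y) :
  unitary u -> implemented_by A Phi u -> masa (bounded_op R Y Y) M.
Proof.
move=> uu iu; have [bu uK u'K] := unitaryP uu; have bu' := bop_adjoint bu.
split.
  apply: linfty_abelian_sa_subalg => _ [a /(roe_linfty hE) Aa <-].
  exact: (emb_bop hPhi).
move=> N [NB _ _ _ Nab] MN; apply/seteqP; split=> // a Na.
pose b := adjoint u \o a \o u.
have ba := NB _ Na.
have bb : bounded_op R X X b by apply: bop_comp => //; exact: bop_comp.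
have comm x (v : l2 R X) : b (dg \1_[set x] v) = dg \1_[set x] (b v).
  have Ax : A (dg \1_[set x]) by apply: roe_indic.
  have Nx : N (Phi (dg \1_[set x])).
    by apply: MN; exists (dg \1_[set x]) => //; apply/linfty_dg/bf_indic.
  have /(congr1 (fun h => adjoint u (h (u v)))) := Nab _ _ Na Nx.
  by rewrite (iu _ Ax) /= !uK.
have bdiag : linfty R X b.
  split=> // -[x y]; rewrite /supp /= /diagonal/= => h.
  apply/eqP; apply: contraNT h => xy; apply/eqP.
  have -> : delta R y = dg \1_[set y] (delta R y).
    by rewrite dg_set1 /rank1 dot_deltar deltaE eqxx scale1r.
  rewrite comm dg_set1 /rank1 dotZl (dot_deltar (delta R y)) deltaE.
  by rewrite (negbTE xy) mulr0.
exists b => //; rewrite iu; last exact: roe_linfty.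
by apply/funext => v; rewrite /b /= !u'K.
Qed.

Lemma masa_roe : masa (bounded_op R Y Y) M -> masa (uniform_roe R F) M.
Proof.
move=> [_ Mmax]; split.
  apply: linfty_abelian_sa_subalg => _ [a /(roe_linfty hE) Aa <-].
  exact: (emb_fun hPhi).
move=> N [NB N0 NM Nadj Nab]; apply: Mmax; split=> // a /NB; exact: roe_bop.
Qed.

Lemma eproj_fin_eq0 v (S : {fset X}) : (forall x, eproj Phi [set x] v = 0) ->
  eproj Phi [set` S] v = 0.
Proof.
move=> h; elim/finSet_rect: S => S IH.
have [->|/fset0Pn [x xS]] := eqVneq S fset0; first by rewrite set_fset0 (eproj_set0 hE hPhi).
have SE : [set` S] = [set x] `|` [set` (S `\ x)%fset].
  by apply/seteqP; split=> z /=; rewrite !inE; [case: eqP; [left|right]|move=> [->|/andP[]]].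
rewrite SE (eprojU hE hPhi); last first.
  by apply/seteqP; split=> // z [/= ->]; rewrite !inE eqxx.
by rewrite fctE h IH ?addr0//; exact: fproperD1.
Qed.

(** The diagonal projections onto finite sets converge strongly to the identity inside the Roe
    algebra. Their images all kill [v], yet converge strongly to [Phi id = id]. *)
Lemma strongly_continuous_total : Phi id = id -> strongly_continuous A Phi ->
  forall v, (forall x, eproj Phi [set x] v = 0) -> v = 0.
Proof.
move=> Phi1 cPhi v v0.
pose P (S : {fset X}) := dg (\1_[set` S] : X -> C).
have FT := @totally_filter X.
have Pid : {ptws, P @ totally --> (id : l2 R X -> l2 R X)}.
  apply/pointwise_cvgP => xi; apply/cvg_l2P => e /(trunc_approx xi) [S SP].
  exists S => // T /= /SP; congr (_ < _); congr (l2norm (_ - _)); apply: l2P => x.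
  rewrite fin_combE dgE; last exact: bf_indic.
  by rewrite indicE mem_setE; case: ifP; rewrite ?mul1r ?mul0r.
have AP S : A (P S) by apply: roe_indic.
have : (fun S => Phi (P S)) @ totally --> (Phi id : {ptws l2 R Y -> l2 R Y}).
  have := cPhi id; rewrite /continuous_at => cid.
  apply: cvg_comp _ cid.
  have idN := @nbhs_subspace_in {ptws l2 R X -> l2 R X} A id (roe_id R hE).
  move=> U NU; have : within A (nbhs (id : {ptws l2 R X -> l2 R X})) U by rewrite idN.
  move=> /Pid; apply: (@filterS _ totally) => S; exact: (fun h => h (AP S)).
move=> /(@pointwise_cvgP (l2 R Y) (l2 R Y))/(_ v)/cvg_l2P h.
apply/eqP/negPn/negP => vn0.
have [S /=] := @filter_ex _ totally FT _ (h _ (l2norm_gt0 vn0)).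
have -> : Phi (P S) v = 0 by exact: eproj_fin_eq0.
by rewrite Phi1 subr0 ltxx.
Qed.

End Implications.

(** * Ultrafilters and the masa condition *)

Section Masa.
Variables (R : realType) (X Y : choiceType).
Variables (E : set (set (X * X))) (F : set (set (Y * Y))).
Hypotheses (hE : coarse_space E) (hF : coarse_space F).
Variable Phi : (l2 R X -> l2 R X) -> l2 R Y -> l2 R Y.
Hypothesis hPhi : embedding (uniform_roe R E) (uniform_roe R F) Phi.
Local Notation C := R[i].
Local Notation A := (uniform_roe R E).
Local Notation B := (uniform_roe R F).
Local Notation M := (Phi @` linfty R X).
Local Notation P := (eproj Phi).
Hypothesis hM : masa B M.
Implicit Types (a b : l2 R Y -> l2 R Y) (v w : l2 R Y) (c : C) (x z : X) (y : Y).
Implicit Types (S T : set X) (f g : X -> C).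

Lemma roe_emb_dg f : bddf f -> A (dg f).
Proof. exact: roe_dg. Qed.

Lemma bop_emb_dg f : bddf f -> bounded_op R Y Y (Phi (dg f)).
Proof. by move=> /roe_emb_dg; exact: (emb_bop hPhi). Qed.

Lemma emb_dgM f g v : bddf f -> bddf g ->
  Phi (dg f) (Phi (dg g) v) = Phi (dg (f * g)) v.
Proof.
by move=> bf bg; rewrite dg_mul// (emb_mul hPhi (roe_emb_dg bf) (roe_emb_dg bg)).
Qed.

Lemma emb_dg_lin c f g v : bddf f -> bddf g ->
  Phi (dg (c *: f + g)) v = c *: Phi (dg f) v + Phi (dg g) v.
Proof.
by move=> bf bg; rewrite dg_lin// (emb_linear hPhi c (roe_emb_dg bf) (roe_emb_dg bg)).
Qed.

Lemma dot_emb_dg f v w : bddf f ->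
  '[Phi (dg f) v, w] = '[v, Phi (dg (fun x => (f x)^*)) w].
Proof.
move=> bf; rewrite adjointP; last exact: bop_emb_dg.
by rewrite -(emb_adjoint hPhi (roe_emb_dg bf)) adjoint_dg.
Qed.

(* The double commutant of M and b, cut down to the Roe algebra, is abelian
   and contains M, so it is M. *)
Lemma masa_commutant b : B b -> adjoint b = b ->
  (forall f, bddf f -> b \o Phi (dg f) = Phi (dg f) \o b) -> M b.
Proof.
move=> Bb sb cb; have [[MB [M0 Ml] MM Madj Mab] Mmax] := hM.
pose S := M `|` [set b].
pose S' := [set d | bounded_op R Y Y d /\ forall s, S s -> d \o s = s \o d].
pose N := [set a | B a /\ forall d, S' d -> a \o d = d \o a].
have SB s : S s -> B s by case=> [/MB|->].
have cbM s : M s -> b \o s = s \o b by move=> [_ /linftyP[f bf ->] <-]; exact: cb.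
have SS' s : S s -> S' s.
  move=> Ss; split; first exact: (roe_bop (SB _ Ss)).
  move=> t; case: Ss => [Ms|->] [Mt|->] //; first exact: Mab.
    by rewrite cbM.
  exact: cbM.
have Sadj s : S s -> S (adjoint s) by case=> [/Madj|->]; [left|right].
have S'adj d : S' d -> S' (adjoint d).
  move=> [bc cS]; split=> [|s Ss]; first exact: bop_adjoint.
  have bs := roe_bop (SB _ Ss).
  have := cS _ (Sadj _ Ss) => /(congr1 (@adjoint R Y Y)).
  rewrite (adjoint_comp bc (bop_adjoint bs)) (adjoint_comp (bop_adjoint bs) bc).
  by rewrite (adjointK bs) => ->.
have NS' a : N a -> S' a.
  by move=> [Ba ha]; split=> [|s Ss]; [exact: (roe_bop Ba)|exact: (ha _ (SS' _ Ss))].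
have MN : M `<=` N by move=> s Ms; split; [exact: MB|move=> d [bd ->//]; left].
suff Nab : abelian_sa_subalg B N.
  by rewrite -(Mmax N Nab MN); split=> // d [bd ->//]; right.
split.
- by move=> a [].
- split=> [|c a a' [Ba ha] [Ba' ha']]; first exact: MN.
  split; first exact: roe_lin.
  move=> d dS'; apply/funext => v; have [bd _] := dS'.
  have /(congr1 (@^~ v)) /= e1 := ha _ dS'; have /(congr1 (@^~ v)) /= e2 := ha' _ dS'.
  by rewrite /= !fctE e1 e2 bopPZ.
- move=> a a' [Ba ha] [Ba' ha']; split; first exact: roe_comp.
  by move=> d dS'; rewrite -compA ha'// compA ha// -compA.
- move=> a [Ba ha]; split; first exact: roe_adjoint.
  move=> d dS'; have [bd _] := dS'.
  have := ha _ (S'adj _ dS') => /(congr1 (@adjoint R Y Y)).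
  have ba := roe_bop Ba.
  rewrite (adjoint_comp ba (bop_adjoint bd)) (adjoint_comp (bop_adjoint bd) ba).
  by rewrite (adjointK bd) => ->.
- by move=> a a' [Ba ha] Na'; apply: ha; exact: NS'.
Qed.

(** The identity commutes with everything, so by maximality it is some [Phi a]; multiplying by
    [Phi id] shows that it is [Phi id]. *)
Lemma emb_id : Phi id = id.
Proof.
have [a la ae] : M id.
  by apply: masa_commutant; [exact: roe_id|exact: adjoint_id|].
have Aa := roe_linfty hE la.
have := emb_mul hPhi (roe_id R hE) Aa.
by rewrite ae /= => ->.
Qed.

Lemma emb_dg1 v : Phi (dg (fun=> 1)) v = v.
Proof. by rewrite dg1 emb_id. Qed.

Lemma bddf_cst c : bddf (fun _ : X => c).
Proof. by exists (normc c). Qed.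

Lemma emb_dg_isometry f v : (forall x, normc (f x) = 1) ->
  l2norm (Phi (dg f) v) = l2norm v.
Proof.
move=> f1; have bf : bddf f by exists 1 => x; rewrite f1.
apply/eqP; rewrite -(@eqrXn2 _ 2) ?l2norm_ge0//; apply/eqP/complexI.
rewrite -!dotxx dot_emb_dg// emb_dgM//; last exact: bf_conj.
rewrite (_ : _ * f = fun=> 1) ?emb_dg1//.
by apply/funext => x; rewrite !fctE mulrC mulJc f1 expr1n.
Qed.

(* Since K^2 - |f|^2 = g^2 with g >= 0, the norms of Phi(f) v and Phi(g) v
   are the legs of a right triangle with hypotenuse K |v|. *)
Lemma emb_dg_le f (K : R) v : 0 <= K -> (forall x, normc (f x) <= K) ->
  l2norm (Phi (dg f) v) <= K * l2norm v.
Proof.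
move=> K0 fK; have bf : bddf f by exists K.
pose g x : C := (Num.sqrt (K ^+ 2 - normc (f x) ^+ 2))%:C%C.
have gsq x : 0 <= K ^+ 2 - normc (f x) ^+ 2.
  by rewrite subr_ge0 ler_sqr ?nnegrE ?normc_ge0.
have bg : bddf g.
  exists K => x; rewrite normc_real ger0_norm ?sqrtr_ge0//.
  by rewrite -[leRHS]ger0_norm// -sqrtr_sqr ler_wsqrtr// lerBlDr lerDl sqr_ge0.
have bfc := bf_conj bf; have bgc := bf_conj bg.
have e : '[Phi (dg f) v, Phi (dg f) v] + '[Phi (dg g) v, Phi (dg g) v] =
    ((K * l2norm v) ^+ 2)%:C%C.
  rewrite !dot_emb_dg// !emb_dgM// -dotDr.
  have := emb_dg_lin 1 v (bf_mul bfc bf) (bf_mul bgc bg).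
  rewrite !scale1r => <-.
  have -> : ((fun x => (f x)^*) * f + (fun x => (g x)^*) * g) =
      (K ^+ 2)%:C%C *: (fun=> 1) + 0.
    apply/funext => x.
    change ((f x)^* * f x + (g x)^* * g x = (K ^+ 2)%:C%C * 1 + 0).
    rewrite addr0 mulr1 -![_^* * _]mulrC !mulJc.
    rewrite normc_real ger0_norm ?sqrtr_ge0// sqr_sqrtr//.
    by rewrite -rmorphD/= addrC subrK.
  rewrite emb_dg_lin; [|exact: bddf_cst|exact: bddf_cst].
  have -> : dg (0 : X -> C) = 0.
    by apply/funext => xi; apply: l2P => x; rewrite dgE ?mul0r//; exact: bddf_cst.
  rewrite (emb0 hE hPhi) addr0 emb_dg1 dotZr dotxx real_complex_conj.
  by rewrite -rmorphM/= exprMn.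
rewrite -ler_sqr ?nnegrE ?mulr_ge0 ?l2norm_ge0//.
move: e; rewrite !dotxx -rmorphD => /complexI <-.
by rewrite lerDl sqr_ge0.
Qed.

Lemma eproj_set1_neq0 x : P [set x] <> 0.
Proof.
move=> q0; have bx := bf_indic R [set x].
have := emb_eq0 hE hPhi (roe_emb_dg bx) q0.
move=> /(congr1 (fun h : l2 R X -> l2 R X => l2_fun (h (delta R x)) x))/eqP.
by rewrite dg_delta// indic_set1 eqxx scale1r deltaE eqxx oner_eq0.
Qed.

(** The limit is the supremum of the levels below [h] on a set of [U]; a level above it fails on a
    set of [U] by the ultrafilter property. *)
Lemma ultra_limit_real (U : set_system X) (h : X -> R) (K : R) : UltraFilter U ->
  (forall x, `|h x| <= K) ->
  exists l, forall e, 0 < e -> U [set x | `|h x - l| <= e].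
Proof.
move=> UU hK.
have FU : ProperFilter U := @ultra_proper _ _ UU.
pose D := [set t | U [set x | t <= h x]].
have hD : has_sup D.
  split; first by exists (- K); apply: filterE => x /=; have := hK x; rewrite ler_norml => /andP[].
  exists K => t Dt; have [x /= tx] := filter_ex Dt.
  by apply: le_trans tx _; have := hK x; rewrite ler_norml => /andP[].
exists (sup D) => e e0.
have [t Dt lt] := sup_adherent e0 hD.
have U2 : U [set x | h x < sup D + e].
  have [De|] := in_ultra_setVsetC [set x | sup D + e <= h x] UU.
    have := ub_le_sup hD.2 De; by rewrite gerDl leNgt e0.
  by apply: filterS => x /= /negP; rewrite -ltNge.
apply: filterS2 Dt U2 => x /= tx xe.
rewrite ler_distl (ltW xe) andbT; exact: le_trans (ltW lt) tx.
Qed.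

Lemma ultra_limit (U : set_system X) f : UltraFilter U -> bddf f ->
  exists l, forall e, 0 < e -> U [set x | normc (f x - l) <= e].
Proof.
move=> UU [K fK].
have FU : ProperFilter U := @ultra_proper _ _ UU.
have [|l1 h1] := @ultra_limit_real U (fun x => complex.Re (f x)) K UU.
  by move=> x; apply: le_trans (fK x); rewrite -lecR; exact: normc_ge_Re.
have [|l2 h2] := @ultra_limit_real U (fun x => complex.Im (f x)) K UU.
  move=> x; apply: le_trans (fK x).
  case: (f x) => s t; rewrite /normc /= -sqrtr_sqr ler_sqrt ?lerDr ?sqr_ge0//.
  by rewrite addr_ge0 ?sqr_ge0.
exists (Complex l1 l2) => e e0; have e2 : 0 < e / 2 by rewrite divr_gt0.
apply: filterS2 (h1 _ e2) (h2 _ e2) => x hs ht.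
change (normc (f x - Complex l1 l2) <= e).
have {}hs : `|complex.Re (f x - Complex l1 l2)| <= e / 2 by move: hs => /=; case: (f x).
have {}ht : `|complex.Im (f x - Complex l1 l2)| <= e / 2 by move: ht => /=; case: (f x).
rewrite [X in normc X]complexE; apply: le_trans (le_normcD _ _) _.
rewrite normcM !normc_real (_ : normc 'i%C = 1); last first.
  by rewrite /normc /= expr0n add0r expr1n sqrtr1.
by rewrite mul1r (splitr e) lerD.
Qed.

Section Ultra.
Variable U : set_system X.
Hypothesis UU : UltraFilter U.
Let FU : ProperFilter U := @ultra_proper _ _ UU.
Local Existing Instance FU.

(** On a set [T] of [U] where [f] is nearly [l], [P T w = w] lets [f - l] be cut down to [T], where
    it is uniformly small. *)
Lemma emb_dg_ultra_eigen f l w : bddf f -> (forall S, U S -> P S w = w) ->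
  (forall e, 0 < e -> U [set x | normc (f x - l) <= e]) -> Phi (dg f) w = l *: w.
Proof.
move=> bf Pw fl; apply/eqP; rewrite -subr_eq0; apply/eqP/l2norm_eq0.
apply/le_anti; rewrite l2norm_ge0 andbT; apply/ler_addgt0Pr => e e0; rewrite add0r.
have w1 : 0 < l2norm w + 1 by rewrite ltr_wpDl// l2norm_ge0.
have UT := fl _ (divr_gt0 e0 w1); set T := (X in U X) in UT.
have bT := bf_indic R T.
have b1 := bddf_cst 1.
have bl : bddf ((- l) *: (fun=> 1) + f) by exact: bf_lin.
have -> : Phi (dg f) w - l *: w = Phi (dg (((- l) *: (fun=> 1) + f) * \1_T)) w.
  rewrite -(emb_dgM w bl bT) (_ : Phi (dg \1_T) w = w); last exact: Pw.
  have -> := emb_dg_lin (- l) w b1 bf.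
  by have -> := emb_dg1 w; rewrite addrC scaleNr.
apply: le_trans (emb_dg_le (K := e / (l2norm w + 1)) _ _ _) _.
- by rewrite divr_ge0// ltW.
- move=> x; change (normc ((- l * 1 + f x) * \1_T x) <= e / (l2norm w + 1)).
  rewrite mulr1 addrC normcM indicE; case: (boolP (x \in T)) => xT.
    by rewrite normc1 mulr1; exact: (set_mem xT).
  by rewrite normc0 mulr0 divr_ge0// ltW.
- by rewrite mulrAC ler_pdivrMr// ler_pM2l// lerDl.
Qed.

(** Replaces [v] by a basis vector, because the projection onto [delta R y] lies in the Roe algebra
    while that onto [v] need not. *)
Lemma ultra_delta v (d : R) : 0 < d -> (forall S, U S -> d <= l2norm (P S v)) ->
  exists y (k : R), 0 < k /\ forall S, U S -> k <= l2norm (P S (delta R y)).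
Proof.
move=> d0 dP; apply: contrapT => H.
have small y (k : R) : 0 < k -> exists S, U S /\ l2norm (P S (delta R y)) < k.
  move=> k0; apply: contrapT => H1; apply: H; exists y, k; split=> // S US.
  by rewrite leNgt; apply/negP => h; apply: H1; exists S.
have d2 : 0 < d / 2 by rewrite divr_gt0.
have [D /(_ _ (fsubset_refl D)) DP] := trunc_approx v d2.
(* Half of [d] pays for the tail of [v]. The other half is divided by [K], which exceeds the sum of
   the coefficients on [D]; finitely many sets of [U] are then intersected. *)
pose K := \sum_(y <- D) normc (v y) + 1.
have K0 : 0 < K by rewrite ltr_wpDl// sumr_ge0// => y _; exact: normc_ge0.
have /choice [S SP] y := small y _ (divr_gt0 d2 K0).
pose T := \bigcap_(y in [set` D]) S y.
have UT : U T by apply: filter_bigI => y _; have [] := SP y.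
have := dP _ UT; apply/negP; rewrite -ltNge.
have bP : bounded_op R Y Y (P T) by exact: (bop_eproj hE hPhi).
rewrite -[v](subrK (fin_comb D v)) bopD// (splitr d).
apply: le_lt_trans (l2normD _ _) _; apply: ltr_leD.
  by apply: le_lt_trans DP; exact: (eproj_le hE hPhi).
rewrite bop_sum//; apply: le_trans (l2norm_sum _ _ _) _.
apply: (@le_trans _ _ (\sum_(y <- D) normc (v y) * (d / 2 / K))).
  rewrite big_seq [leRHS]big_seq; apply: ler_sum => y yD.
  rewrite bopZ// l2normZ ler_wpM2l ?normc_ge0//.
  have [_ /ltW] := SP y; apply: le_trans; apply: (eproj_subset hE hPhi).
  by move=> x; apply.
rewrite -mulr_suml mulrA ler_pdivrMr// mulrC ler_wpM2l ?(ltW d2)// lerDl//.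
Qed.

Lemma eproj_subE S T v :
  l2norm (P S v - P (S `&` T) v) ^+ 2 = l2norm (P S v) ^+ 2 - l2norm (P (S `&` T) v) ^+ 2.
Proof.
apply/eqP; rewrite -subr_eq opprK; apply/eqP.
rewrite -pythagoras ?subrK// dotBl !(dot_eproj hE hPhi) !(eprojE hE hPhi).
by rewrite setIA setIid [S `&` T `&` _]setIid subrr.
Qed.

(** The squared norm of [P S (delta y)] decreases as [S] shrinks. Sets [S n] almost attaining its
    infimum over [U] give a Cauchy sequence, whose limit [w] is unmoved by any [P T] with [T] in [U]
    and is nonzero because of [k]. The operator [rank1 w w] is the norm limit of the compressions of
    the matrix unit at [y]. *)
Lemma ultra_eigenvector y (k : R) : 0 < k ->
  (forall S, U S -> k <= l2norm (P S (delta R y))) ->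
  exists w, [/\ w != 0, forall S, U S -> P S w = w & B (rank1 w w)].
Proof.
move=> k0 kP; set t := delta R y in kP.
have t1 S : l2norm (P S t) <= 1 by rewrite -(l2norm_delta R y); exact: (eproj_le hE hPhi).
have good e : 0 < e -> exists S, U S /\
    forall T, U T -> l2norm (P S t - P (S `&` T) t) <= e.
  move=> e0; pose D := [set l2norm (P S t) ^+ 2 | S in U].
  have hD : has_inf D.
    split; first by exists (l2norm (P setT t) ^+ 2), setT => //; exact: filterT.
    by exists 0 => _ [S _ <-]; exact: sqr_ge0.
  have [_ [S US <-] lt] := inf_adherent (exprn_gt0 2 e0) hD.
  exists S; split=> // T UT.
  rewrite -ler_sqr ?nnegrE ?l2norm_ge0 ?(ltW e0)// eproj_subE lerBlDr.
  apply: le_trans (ltW lt) _; rewrite addrC lerD2l; apply: (ge_inf hD.2).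
  by exists (S `&` T) => //; exact: filterI.
have /choice [S SP] (n : nat) := good n.+1%:R^-1 (ltac:(by rewrite invr_gt0)).
have SD n T : U T -> l2norm (P (S n) t - P (S n `&` T) t) <= n.+1%:R^-1.
  by have [_] := SP n; apply.
have small (e : R) : 0 < e -> exists N, forall n, (N <= n)%N -> n.+1%:R^-1 < e.
  move=> e0; exists (Num.bound e^-1) => n Nn; rewrite invf_plt ?posrE//.
  apply: lt_le_trans (archi_boundP _) _; first by rewrite invr_ge0 ltW.
  by rewrite ler_nat (leq_trans Nn).
have [|w wP] := @l2_complete _ _ (fun n => P (S n) t).
  move=> e e0; have [N NP] := small (e / 2) (divr_gt0 e0 (ltr0Sn R 1)).
  exists N => m n Nm Nn.
  (* Both terms are compared with their common refinement, to which neither can lose much norm. *)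
  have -> : P (S m) t - P (S n) t = (P (S m) t - P (S m `&` S n) t)
      - (P (S n) t - P (S n `&` S m) t).
    by rewrite [S n `&` _]setIC opprB addrA subrK.
  apply: le_lt_trans (l2normD _ _) _; rewrite l2normN (splitr e) ltrD//.
    by apply: le_lt_trans (SD _ _ (SP n).1) _; exact: NP.
  by apply: le_lt_trans (SD _ _ (SP m).1) _; exact: NP.
have approx (e : R) : 0 < e -> exists n, l2norm (w - P (S n) t) <= e /\ n.+1%:R^-1 <= e.
  move=> e0; have [N NP] := wP _ e0; have [N' N'P] := small _ e0.
  exists (maxn N N'); split; first by apply: NP; exact: leq_maxl.
  by apply/ltW/N'P; exact: leq_maxr.
exists w; split.
- apply/eqP => w0; have [n []] := approx (k / 2) (divr_gt0 k0 (ltr0Sn R 1)).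
  rewrite w0 sub0r l2normN => + _; apply/negP; rewrite -ltNge.
  apply: lt_le_trans (kP _ (SP n).1).
  by rewrite ltr_pdivrMr// ltr_pMr// ltr1n.
- move=> T UT; apply/eqP; rewrite -subr_eq0; apply/eqP/l2norm_eq0.
  apply/le_anti; rewrite l2norm_ge0 andbT; apply/ler_addgt0Pr => e e0; rewrite add0r.
  have e3 : 0 < e / 3 by rewrite divr_gt0.
  have [n [nP n1]] := approx _ e3.
  have bP : bounded_op R Y Y (P T) by exact: (bop_eproj hE hPhi).
  have -> : P T w - w = P T (w - P (S n) t) - (P (S n) t - P (S n `&` T) t)
      - (w - P (S n) t).
    rewrite (bopB _ _ bP) (eprojE hE hPhi) setIC !opprB !addrA subrK.
    by rewrite subrK.
  apply: (@le_trans _ _ (e / 3 + e / 3 + e / 3)); last by lra.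
  apply: le_trans (l2normB_le _ _) _; apply: lerD => //.
  apply: le_trans (l2normB_le _ _) _; apply: lerD.
    exact: le_trans (eproj_le hE hPhi T _) nP.
  exact: le_trans (SD _ _ UT) n1.
- apply: roe_closed; first exact: bop_rank1.
  move=> e e0; have w1 : 0 < l2norm w + 1 by rewrite ltr_wpDl// l2norm_ge0.
  have [n [nP _]] := approx _ (divr_gt0 e0 w1).
  have BP : B (P (S n)) by apply: (emb_fun hPhi); exact: roe_indic.
  have bP := roe_bop BP.
  exists (rank1 (P (S n) t) (P (S n) t)).
    have -> : rank1 (P (S n) t) (P (S n) t) = P (S n) \o rank1 t t \o P (S n).
      by rewrite comp_rank1// rank1_comp// (adjoint_eproj hE hPhi).
    have Bt : B (rank1 t t).
      by apply: (roe_rank1 _ hF); apply: (coarse_sub hF) (coarse_diag hF) => _ ->.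
    exact: (roe_comp hF (roe_comp hF BP Bt) BP).
  move=> v; apply: le_trans (rank1_sub_le _ _ _ _ _) _.
  rewrite ler_wpM2r ?l2norm_ge0//.
  apply: (@le_trans _ _ (e / (l2norm w + 1) * (l2norm w + 1))).
    rewrite mulrDr mulr1 lerD// ?ler_wpM2r ?l2norm_ge0//.
    apply: le_trans nP.
    by rewrite ler_piMl ?l2norm_ge0.
  by rewrite divfK// gt_eqF.
Qed.

(* A nonzero joint eigenvector w of M along U can be chosen with the
   projection onto w in the Roe algebra; by maximality this projection lies
   in M, which forces U to be principal. *)
Lemma ultra_principal v (d : R) : 0 < d -> (forall S, U S -> d <= l2norm (P S v)) ->
  exists2 x, U [set x] & has_rank 1 (P [set x]).
Proof.
move=> d0 dP; have [y [k [k0 kP]]] := ultra_delta d0 dP.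
have [w [w0 Pw Bw]] := ultra_eigenvector k0 kP.
have eigen f : bddf f -> exists l, Phi (dg f) w = l *: w /\
    Phi (dg (fun x => (f x)^*)) w = l^* *: w.
  move=> bf; have [l lP] := ultra_limit UU bf; exists l; split.
    exact: emb_dg_ultra_eigen.
  apply: emb_dg_ultra_eigen => //; first exact: bf_conj.
  by move=> e /lP; apply: filterS => x /=; rewrite -rmorphB normcJr.
have [_ /linftyP [g bg ->] gw] : M (rank1 w w).
  apply: masa_commutant => //; first exact: adjoint_rank1.
  move=> f bf; have [l [fw fcw]] := eigen _ bf.
  rewrite rank1_comp ?comp_rank1; [|exact: bop_emb_dg..].
  rewrite -(emb_adjoint hPhi (roe_emb_dg bf)) adjoint_dg// fw fcw.
  by apply/funext => u; rewrite /rank1 dotZr conjCK scalerA mulrC.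
have [x gx] : exists x, g x != 0.
  apply: contrapT => H; have g0 : dg g = 0.
    apply/funext => xi; apply: l2P => x; rewrite dgE//.
    have [->|gx] := eqVneq (g x) 0; first by rewrite mul0r.
    by case: H; exists x.
  move: gw; rewrite g0 (emb0 hE hPhi) => /(congr1 (fun h => h w))/esym/eqP.
  rewrite /rank1 scaler_eq0 (negbTE w0) orbF dotxx (inj_eq (@complexI R) _ 0).
  by rewrite expf_eq0 gt_eqF// l2norm_gt0.
have bx := bf_indic R [set x].
(* On [[set x]] the function [g] is the nonzero constant [g x], so the image of [dg g] there is a
   multiple of [P [set x]]; being also [rank1 w w], it forces the range into the line of [w]. *)
have qE v' : P [set x] v' = ('[P [set x] v', w] / g x) *: w.
  have /(congr1 (fun h => h (P [set x] v'))) := gw.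
  rewrite emb_dgM// (_ : g * \1_[set x] = g x *: \1_[set x] + 0); last first.
    apply/funext => z; change (g z * \1_[set x] z = g x * \1_[set x] z + 0).
    rewrite addr0 indic_set1.
    by have [->//|] := eqVneq z x; rewrite !mulr0.
  rewrite emb_dg_lin//; last exact: bddf_cst.
  have -> : dg (0 : X -> C) = 0.
    by apply/funext => xi; apply: l2P => z; rewrite dgE ?mul0r//; exact: bddf_cst.
  rewrite (emb0 hE hPhi) addr0 /rank1 -/(P [set x]) => e.
  by rewrite mulrC -scalerA -e scalerA mulVf// scale1r.
have qw : P [set x] w != 0.
  apply/eqP => qw0; apply: (@eproj_set1_neq0 x).
  by apply/funext => u; rewrite qE (dot_eproj hE hPhi) qw0 dot0r mul0r scale0r.
(* Otherwise the complement of [[set x]] is in [U] and fixes [w], so that [P [set x]] would kill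
   [w]. *)
have Ux : U [set x].
  have [//|Ux] := in_ultra_setVsetC [set x] UU.
  case/eqP: qw; rewrite -(Pw _ Ux) (eprojE hE hPhi) setICr.
  by rewrite (eproj_set0 hE hPhi).
exists x => //; apply: (has_rank1 w0); apply/seteqP; split=> [_ [u _ <-]|_ [c _ <-]].
  by rewrite qE; exists ('[P [set x] u, w] / g x).
exists (c *: w) => //; rewrite bopZ ?Pw//.
exact: (bop_eproj hE hPhi).
Qed.

End Ultra.

Lemma rank1_eproj x : has_rank 1 (P [set x]).
Proof.
have UU := principal_filter_ultra x.
have [v vx] : exists v, P [set x] v != 0.
  apply: contrapT => H; apply: (@eproj_set1_neq0 x).
  by apply/funext => v; apply/eqP/negPn/negP => h; apply: H; exists v.
have [|z /principal_filterP zx rz] := @ultra_principal _ UU v _ (l2norm_gt0 vx).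
  by move=> S /principal_filterP Sx; apply: (eproj_subset hE hPhi) => _ ->.
by rewrite (_ : x = z)// zx.
Qed.

End Masa.

(** * Fourth moments of random signs *)

Section RandomSigns.
Variables (R : realType) (Y : choiceType).
Local Notation C := R[i].
Local Notation H := (l2 R Y).
Implicit Types (a : nat -> H) (c v : H) (h k s : Y -> R).

(** Extended real values postpone all questions of summability. *)
Definition rsum (h : Y -> R) : \bar R := (\esum_(z in setT) (h z)%:E)%E.

Lemma rsumD h k : (forall z, 0 <= h z) -> (forall z, 0 <= k z) ->
  rsum (fun z => h z + k z)%R = (rsum h + rsum k)%E.
Proof.
move=> h0 k0; rewrite /rsum -esumD => [|z _|z _]; rewrite ?lee_fin//.
Qed.

Lemma rsum_le h k : (forall z, h z <= k z) -> (rsum h <= rsum k)%E.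
Proof. by move=> hk; apply: le_esum => z _; rewrite lee_fin. Qed.

Lemma le_rsum h z : (forall z, 0 <= h z) -> ((h z)%:E <= rsum h)%E.
Proof.
by move=> h0; apply: esum_ge; exists [set z]; [split=> //; exact: finite_set1|rewrite fsbig_set1].
Qed.

Lemma parallelogram (x y : C) :
  normc (x + y) ^+ 2 + normc (x - y) ^+ 2 = 2 * normc x ^+ 2 + 2 * normc y ^+ 2.
Proof.
case: x y => [x1 x2] [y1 y2]; rewrite /normc /=.
by rewrite !sqr_sqrtr ?addr_ge0 ?sqr_ge0//; ring.
Qed.

(** The difference of squares is four times the real part of x times the conjugate of y; the slack
    is the square of the imaginary part, up to the factor 16. *)
Lemma cross_term_le (x y : C) :
  (normc (x + y) ^+ 2 - normc (x - y) ^+ 2) ^+ 2 <= 16 * normc x ^+ 2 * normc y ^+ 2.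
Proof.
case: x y => [x1 x2] [y1 y2]; rewrite /normc /=.
rewrite !sqr_sqrtr ?addr_ge0 ?sqr_ge0// -subr_ge0.
rewrite (_ : _ - _ = 16 * (x1 * y2 - x2 * y1) ^+ 2); last by ring.
by rewrite mulr_ge0// sqr_ge0.
Qed.

Definition sqs a n (z : Y) : R := \sum_(i < n) normc (a i z) ^+ 2.

Lemma sqs_ge0 a n z : 0 <= sqs a n z.
Proof. by apply: sumr_ge0 => i _; exact: sqr_ge0. Qed.

(* The fourth moment of |p + e_1 q_1 + ... + e_n q_n| over independent random
   signs e_i, with |p|^2 = x and s the sum of the |q_i|^2, is at most this. *)
Definition moment4 (x s : R) : R := x ^+ 2 + 6 * x * s + 3 * s ^+ 2.

Lemma moment4_ge0 (x s : R) : 0 <= x -> 0 <= s -> 0 <= moment4 x s.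
Proof. by move=> x0 s0; rewrite !addr_ge0 ?mulr_ge0 ?sqr_ge0. Qed.

(** Averages over one more sign. The coefficients 6 and 3 fit the recursion: after the parallelogram
    law and the cross term bound, the right side still exceeds the left by four times the fourth
    power of |y|. *)
Lemma moment4_step (x y : C) (s : R) : 0 <= s ->
  moment4 (normc (x + y) ^+ 2) s + moment4 (normc (x - y) ^+ 2) s <=
  2 * moment4 (normc x ^+ 2) (s + normc y ^+ 2).
Proof.
move=> s0; have := parallelogram x y; have := cross_term_le x y.
have : 0 <= normc y ^+ 2 by exact: sqr_ge0.
have : 0 <= normc x ^+ 2 by exact: sqr_ge0.
rewrite /moment4.
move: (normc x ^+ 2) (normc y ^+ 2) (normc (x + y) ^+ 2) (normc (x - y) ^+ 2).
move=> p q u w p0 q0 hc hp.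
have e : u ^+ 2 + w ^+ 2 = ((u + w) ^+ 2 + (u - w) ^+ 2) / 2 by field.
have e' : 6 * u * s + 6 * w * s = 6 * (u + w) * s by ring.
rewrite (_ : _ + _ = (u ^+ 2 + w ^+ 2) + (6 * u * s + 6 * w * s) + 6 * s ^+ 2); last by ring.
rewrite e e' hp.
nra.
Qed.

(** The method of conditional expectations replaces a probability space: the sign of the last vector
    is fixed so that the moment bound does not exceed its average over both signs, and the chosen
    term is absorbed into [c]. *)
Lemma sign_choice n a c : exists e : nat -> C, (forall i, normc (e i) = 1) /\
  (rsum (fun z => normc ((c + \sum_(i < n) e i *: a i) z) ^+ 4)%R <=
   rsum (fun z => moment4 (normc (c z) ^+ 2) (sqs a n z))%R)%E.
Proof.
elim: n c => [|n IH] c.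
  exists (fun=> 1); split=> [i|]; first by rewrite normc1.
  apply: rsum_le => z; rewrite big_ord0 addr0 /sqs big_ord0 /moment4.
  by rewrite mulr0 expr0n mulr0 !addr0 -exprM.
pose m (b : H) z := moment4 (normc (b z) ^+ 2) (sqs a n z).
have m0 b z : 0 <= m b z by apply: moment4_ge0; [exact: sqr_ge0|exact: sqs_ge0].
pose m' z := moment4 (normc (c z) ^+ 2) (sqs a n.+1 z).
have m'0 z : 0 <= m' z by apply: moment4_ge0; [exact: sqr_ge0|exact: sqs_ge0].
have le2 : (rsum (m (c + a n)%R) + rsum (m (c - a n)%R) <= rsum m' + rsum m')%E.
  rewrite -!rsumD//; apply: rsum_le => z.
  rewrite -mulr2n -mulr_natl /m' /sqs big_ord_recr.
  exact: (moment4_step (c z) (a n z) (sqs_ge0 a n z)).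
have [t t1 tP] : exists2 t : C, normc t = 1 & (rsum (m (c + t *: a n)%R) <= rsum m')%E.
  have [h|h] := leP (rsum (m (c + a n))) (rsum m').
    by exists 1; rewrite ?normc1 ?scale1r.
  exists (-1); rewrite ?normcN ?normc1// scaleN1r.
  rewrite leNgt; apply/negP => h'.
  (* An infinite bound was already covered by the sign +1; here finiteness allows adding two strict
     inequalities. *)
  have fin : rsum m' \is a fin_num.
    by rewrite ge0_fin_numE ?(lt_le_trans h) ?leey// esum_ge0// => z _; rewrite lee_fin.
  by have := lt_le_trans (lte_leD fin h (ltW h')) le2; rewrite ltxx.
have [e [e1 eP]] := IH (c + t *: a n).
exists (fun i => if i == n then t else e i); split.
  by move=> i; case: ifP.
apply: le_trans tP; apply: le_trans eP; apply: rsum_le => z.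
rewrite (_ : c + _ = c + t *: a n + \sum_(i < n) e i *: a i)//.
rewrite big_ord_recr /= eqxx -addrA [t *: _ + _]addrC; congr (c + (_ + _)).
by apply: eq_bigr => i _; rewrite ltn_eqF.
Qed.

Lemma rsum_sqs a n : rsum (sqs a n) = (\sum_(i < n) l2norm (a i) ^+ 2)%:E.
Proof.
elim: n => [|n IH].
  by rewrite big_ord0 /rsum esum1// => z _; rewrite /sqs big_ord0.
rewrite big_ord_recr EFinD -IH l2norm_sqr -[sqsum _]/(rsum (fun z => normc (a n z) ^+ 2)).
rewrite -rsumD => [||z]; [|exact: sqs_ge0|exact: sqr_ge0].
by congr rsum; apply/funext => z; rewrite /sqs big_ord_recr.
Qed.

(** With [c = 0] the moment bound is three times the square of [sqs], of which one factor is at most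
    [d] and the other sums to the squared norms. One coordinate is bounded by the whole sum, which
    makes the estimate uniform in [z]. *)
Lemma spread_signs n a (d : R) : (forall z, sqs a n z <= d) ->
  exists e : nat -> C, (forall i, normc (e i) = 1) /\
    forall z, normc ((\sum_(i < n) e i *: a i) z) ^+ 4 <=
      3 * d * \sum_(i < n) l2norm (a i) ^+ 2.
Proof.
move=> ad; have [e [e1 eP]] := sign_choice n a 0; exists e; split=> // z.
have d0 : 0 <= d by apply: le_trans (ad z); exact: sqs_ge0.
rewrite -lee_fin; apply: le_trans (le_trans eP _).
  under [in leRHS]eq_fun do rewrite add0r.
  by apply: (@le_rsum (fun z => _) z) => z'; exact/exprn_ge0/normc_ge0.
rewrite EFinM -rsum_sqs /rsum -esum_scale ?mulr_ge0//; apply: rsum_le => z'.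
rewrite /moment4 l20E normc0 expr0n /= expr0n mulr0 mul0r !add0r expr2 -mulrA.
by rewrite ler_pM2l// ler_wpM2r ?sqs_ge0.
Qed.

End RandomSigns.

(** * No vector is killed by all atoms *)

Section Total.
Variables (R : realType) (X Y : choiceType).
Variables (E : set (set (X * X))) (F : set (set (Y * Y))).
Hypotheses (hE : coarse_space E) (hF : coarse_space F).
Hypothesis hFf : uniformly_locally_finite F.
Variable Phi : (l2 R X -> l2 R X) -> l2 R Y -> l2 R Y.
Hypothesis hPhi : embedding (uniform_roe R E) (uniform_roe R F) Phi.
Local Notation C := R[i].
Local Notation A := (uniform_roe R E).
Local Notation B := (uniform_roe R F).
Local Notation M := (Phi @` linfty R X).
Local Notation P := (eproj Phi).
Local Notation fiber c i := (c @^-1` [set (i : nat)]).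
Hypothesis hM : masa B M.
Implicit Types (v w : l2 R Y) (x : X) (y : Y) (S T D G : set X).

Lemma eproj_setT v : P setT v = v.
Proof. by rewrite /eproj indicT (emb_dg1 hE hF hPhi hM). Qed.

Lemma eproj_split S G v : P S v = P (S `&` G) v + P (S `\` G) v.
Proof.
rewrite -{1}(setUIDK S G) (eprojU hE hPhi)//.
by apply/seteqP; split=> // x [[_ ?] []].
Qed.

(** The sets that split into finitely many pieces small on [v] form an ideal. Were it proper, an
    ultrafilter containing all complements would have [P] bounded below on [v], hence be principal
    at some x; but [[set x]] is in the ideal. *)
Lemma diffuse v (d : R) : (forall x, P [set x] v = 0) -> 0 < d ->
  exists n (c : X -> nat), (forall x, (c x < n)%N) /\
    forall i, (i < n)%N -> l2norm (P (fiber c i) v) < d.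
Proof.
move=> v0 d0.
pose small S := exists n (c : X -> nat), (forall x, S x -> (c x < n)%N) /\
    forall i, (i < n)%N -> l2norm (P (S `&` fiber c i) v) < d.
have smallS S T : S `<=` T -> small T -> small S.
  move=> ST [n [c [cn cd]]]; exists n, c; split=> [x /ST/cn//|i /cd].
  by apply: le_lt_trans; apply: (eproj_subset hE hPhi); exact: setSI.
have smallU S T : small S -> small T -> small (S `|` T).
  move=> [m [b [bm bd]]] [n [c [cn cd]]].
  (* Partitions are colourings: [S] keeps its [m] colours, the rest of [T] gets its own shifted by
     [m]. *)
  exists (m + n)%N, (fun x => if x \in S then b x else m + c x)%N; split.
    move=> x STx; case: ifPn => [/set_mem/bm|]; first exact: ltn_addr.
    by rewrite notin_setE => Sx; case: STx => // /cn; rewrite ltn_add2l.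
  move=> i imn; have [im|mi] := ltnP i m.
    apply: le_lt_trans (bd _ im); apply: (eproj_subset hE hPhi) => x [_ /=].
    case: ifPn => [/set_mem Sx//|_ e].
    by move: im; rewrite -e ltnNge leq_addr.
  have ni : (i - m < n)%N by rewrite ltn_subLR.
  apply: le_lt_trans (cd _ ni); apply: (eproj_subset hE hPhi) => x [STx /=].
  case: ifPn => [/set_mem/bm + e|]; first by rewrite e ltnNge mi.
  by rewrite notin_setE => Sx <-; case: STx => // Tx; rewrite addKn.
have [|nT] := pselect (small setT).
  move=> [n [c [cn cd]]]; exists n, c; split=> [x|i /cd]; first exact: cn.
  by rewrite setTI.
pose U0 : set_system X := [set S | small (~` S)].
have U0F : ProperFilter U0.
  apply: Build_ProperFilter_ex => [S US|].
    apply: contrapT => S0; apply: nT; move: US; rewrite /U0 /=.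
    by rewrite (_ : S = set0) ?setC0//; apply/seteqP; split=> // x Sx; case: S0; exists x.
  split.
  - by exists 0%N, (fun=> 0%N); split=> // x; rewrite setCT.
  - by move=> S T; rewrite /U0 /= setCI; exact: smallU.
  - by move=> S T ST; apply: smallS; exact: subsetC.
have [U [UU U0U]] := ultraFilterLemma U0F.
have UF : ProperFilter U := @ultra_proper _ _ UU.
have small1 S : l2norm (P S v) < d -> small S.
  move=> Sd; exists 1%N, (fun=> 0%N); split=> [//|i _].
  by apply: le_lt_trans Sd; apply: (eproj_subset hE hPhi); exact: subIsetl.
have [|x Ux _] := ultra_principal hE hF hPhi hM UU d0 (v := v).
  move=> S US; rewrite leNgt; apply/negP => Sd.
  have : U (~` S).
    by apply: U0U; rewrite /U0 /= setCK; exact: small1.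
  by move=> /(filterI US); rewrite setICr; exact: filter_not_empty.
exfalso; have : U (~` [set x]).
  by apply: U0U; rewrite /U0 /= setCK; apply: small1; rewrite v0 l2norm0.
by move=> /(filterI Ux); rewrite setICr; exact: filter_not_empty.
Qed.

Lemma emb_dg_pieces n (c : X -> nat) (e : nat -> C) v :
  (forall x, (c x < n)%N) -> (forall i, normc (e i) = 1) ->
  Phi (dg (fun x => e (c x))) v = \sum_(i < n) e i *: P (fiber c i) v.
Proof.
move=> cn e1.
(* Cutting off the colours from [m] on allows induction on the number of colours. *)
pose f m x : C := if (c x < m)%N then e (c x) else 0.
have bf m : bddf (f m) by exists 1 => x; rewrite /f; case: ifP; rewrite ?e1 ?normc0.
have -> : (fun x => e (c x)) = f n by apply/funext => x; rewrite /f cn.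
elim: n {cn} => [|n IH].
  rewrite big_ord0 (_ : dg (f 0%N) = 0) ?(emb0 hE hPhi)//.
  by apply/funext => xi; apply: l2P => x; rewrite dgE// mul0r.
rewrite big_ord_recr /= -IH addrC -(emb_dg_lin hE hPhi (e n) v (bf_indic R _) (bf n)).
congr (Phi (dg _) v); apply/funext => x.
change (f n.+1 x = e n * \1_(fiber c n) x + f n x).
rewrite /f indicE ltnS leq_eqVlt; have [cx|cx] := eqVneq (c x) n.
  by rewrite mem_set//= cx ltnn mulr1 addr0.
by rewrite memNset ?mulr0 ?add0r//= => /eqP; rewrite (negbTE cx).
Qed.

Lemma sum_pieces n (c : X -> nat) v : (forall x, (c x < n)%N) ->
  \sum_(i < n) P (fiber c i) v = v.
Proof.
move=> cn.
have one (i : nat) : normc (1 : C) = 1 by exact: normc1.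
have h := @emb_dg_pieces n c (fun=> 1) v cn one.
rewrite -[RHS](emb_dg1 hE hF hPhi hM); apply: etrans (esym h).
by apply: eq_bigr => i _; rewrite scale1r.
Qed.

Lemma sum_pieces_sqr n (c : X -> nat) v : (forall x, (c x < n)%N) ->
  \sum_(i < n) l2norm (P (fiber c i) v) ^+ 2 = l2norm v ^+ 2.
Proof.
move=> cn.
have := @pythagoras_sum R Y 'I_n (index_enum 'I_n) (fun i => P (fiber c i) v)
  (index_enum_uniq _).
rewrite (sum_pieces v cn) => -> // i j ij.
rewrite (dot_eproj hE hPhi) (eprojE hE hPhi) (_ : _ `&` _ = set0).
  by rewrite (eproj_set0 hE hPhi) dot0r.
apply/seteqP; split=> // x [/= ci cj]; case/eqP: ij.
by apply: val_inj; exact: etrans (esym ci) cj.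
Qed.

Lemma spread v (tau : R) : (forall x, P [set x] v = 0) -> 0 < tau ->
  exists r : X -> C, (forall x, normc (r x) = 1) /\
    forall z, normc (Phi (dg r) v z) ^+ 2 <= tau.
Proof.
move=> v0 tau0; pose K := l2norm v ^+ 2.
have K1 : 0 < 3 * (K + 1) by rewrite mulr_gt0// ltr_wpDl// sqr_ge0.
(* Chosen so that the fourth moment bound [3 * d2 * K] is at most [tau ^+ 2]; the 1 covers
   [K = 0]. *)
pose d2 := tau ^+ 2 / (3 * (K + 1)).
have d20 : 0 < d2 by rewrite divr_gt0// exprn_gt0.
have d0 : 0 < Num.sqrt d2 by rewrite sqrtr_gt0.
have [n [c [cn cd]]] := diffuse v0 d0.
pose a i := P (fiber c i) v.
(* By Cauchy-Schwarz between the pieces of [v] and of [delta R z]: each piece of [v] has squared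
   norm at most [d2], and those of [delta R z] add up to 1. *)
have [|e [e1 eP]] := @spread_signs R Y n a d2.
  move=> z; rewrite /sqs -[leRHS]mulr1 -(expr1n _ 2) -(l2norm_delta R z).
  rewrite -(sum_pieces_sqr (delta R z) cn) mulr_sumr; apply: ler_sum => i _.
  rewrite -dot_deltar /a -[fiber c i]setIid -(eprojE hE hPhi) (dot_eproj hE hPhi) setIid.
  apply: (@le_trans _ _ ((l2norm (a i) * l2norm (P (fiber c i) (delta R z))) ^+ 2)).
    by rewrite ler_sqr ?nnegrE ?normc_ge0 ?mulr_ge0 ?l2norm_ge0// normc_dot_le.
  rewrite exprMn ler_wpM2r ?sqr_ge0// -[leRHS]sqr_sqrtr ?(ltW d20)//.
  rewrite ler_sqr ?nnegrE ?l2norm_ge0 ?sqrtr_ge0//; apply/ltW; exact: cd.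
exists (fun x => e (c x)); split=> // z.
rewrite (emb_dg_pieces v cn e1) -ler_sqr ?nnegrE ?sqr_ge0 ?(ltW tau0)// -exprM.
apply: le_trans (eP z) _; rewrite (sum_pieces_sqr v cn) -/K /d2.
have K0 : 0 < K + 1 by rewrite ltr_wpDl// sqr_ge0.
rewrite (_ : 3 * _ * K = tau ^+ 2 * K / (K + 1)); last by field; rewrite gt_eqF.
by rewrite ler_pdivrMr// ler_wpM2l ?sqr_ge0// lerDl.
Qed.

(** In a partition whose pieces are all smaller on [P S v] than its norm, some piece is nonzero and
    none exhausts the vector. *)
Lemma eproj_split_neq0 v S : (forall x, P [set x] v = 0) -> P S v != 0 ->
  exists G, P (S `&` G) v != 0 /\ P (S `\` G) v != 0.
Proof.
move=> v0 Sv; pose w := P S v.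
have w0 x : P [set x] w = 0.
  by rewrite /w (eprojE hE hPhi) setIC -(eprojE hE hPhi) v0 bop0//; exact: (bop_eproj hE hPhi).
have [n [c [cn cd]]] := diffuse w0 (l2norm_gt0 Sv).
have [i iw] : exists i : 'I_n, P (fiber c i) w != 0.
  apply: contrapT => H; case/eqP: Sv; rewrite -[LHS](sum_pieces _ cn) big1// => i _.
  by apply/eqP/negPn/negP => h; apply: H; exists i.
have e : P (fiber c i) w = P (S `&` fiber c i) v.
  by rewrite /w (eprojE hE hPhi) setIC.
exists (fiber c i); split; first by rewrite -e.
apply/eqP => h; have := eproj_split S (fiber c i) v.
rewrite h addr0 -e -/w => we; have := cd _ (ltn_ord i).
by rewrite -we ltxx.
Qed.

Lemma masa_total v : (forall x, P [set x] v = 0) -> v = 0.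
Proof.
move=> v0; apply/eqP/negPn/negP => vn0.
have PP S T w := eprojE hE hPhi S T w.
have bP S := bop_eproj hE hPhi S.
have /choice [g gP] S : exists G, P S v != 0 -> P (S `&` G) v != 0 /\ P (S `\` G) v != 0.
  have [h|h] := eqVneq (P S v) 0; first by exists set0 => /negP; case; exact/eqP.
  by have [G GP] := eproj_split_neq0 v0 h; exists G.
(* Repeated splitting: [D n] is the part removed at stage [n], and the remainder still sees [v], so
   the process never stops. *)
pose S n := iter n (fun T => T `\` g T) setT.
pose D n := S n `&` g (S n).
have Sv n : P (S n) v != 0.
  by elim: n => [|n /gP[]//]; rewrite /S /= eproj_setT.
have Dv n : P (D n) v != 0 by have [] := gP _ (Sv n).
have Smono m n : (m <= n)%N -> S n `<=` S m.
  elim: n => [|n IH]; first by rewrite leqn0 => /eqP ->.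
  by rewrite leq_eqVlt => /predU1P[->//|/IH h]; apply: subset_trans h => x [].
have Ddisj m n x : D m x -> D n x -> m = n.
  have H i j : D i x -> D j x -> ~ (i < j)%N.
    move=> [_ gx] [Sx _] ij; have [_] : S i.+1 x by exact: (Smono _ _ ij _ Sx).
    by apply.
  move=> Dm Dn; apply/eqP; rewrite eqn_leq.
  by apply/andP; split; rewrite leqNgt; apply/negP; [exact: (H _ _ Dn Dm)|exact: (H _ _ Dm Dn)].
pose w n := P (D n) v; pose xi n := ((l2norm (w n))^-1)%:C%C *: w n.
have xi1 n : l2norm (xi n) = 1.
  rewrite l2normZ normc_real ger0_norm ?invr_ge0 ?l2norm_ge0// mulVf//.
  by rewrite gt_eqF//; exact: (l2norm_gt0 (Dv n)).
have Dxi n : P (D n) (xi n) = xi n by rewrite /xi bopZ// /w PP setIid.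
have xi0 n x : P [set x] (xi n) = 0.
  by rewrite /xi bopZ// /w PP setIC -PP v0 bop0// scaler0.
have q4 : 0 < 4^-1 :> R by rewrite invr_gt0.
have /choice [Q QP] n : exists Q : {fset Y}, l2norm (xi n - fin_comb Q (xi n)) < 4^-1.
  by have [Q QP] := trunc_approx (xi n) q4; exists Q; apply: QP.
(* If columns have at most [n] nonzero entries, the image of a vector supported on [Q n] lives on at
   most [n * #|Q n|] points; coordinates with squares at most [tau n] carry at most half of the unit
   mass there. *)
pose tau n : R := 2^-1 / (n * #|` Q n|).+1%:R.
have tau0 n : 0 < tau n by rewrite divr_gt0.
have /choice [r rP] n := spread (xi0 n) (tau0 n).
pose rr x : C := if pselect (exists n, D n x) is left h then r (projT1 (cid h)) x else 0.
have rrD n x : D n x -> rr x = r n x.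
  move=> Dx; rewrite /rr; case: pselect => [h|[]]; last by exists n.
  by case: cid => m /= Dm; rewrite (Ddisj _ _ _ Dm Dx).
have rr1 x : normc (rr x) <= 1.
  by rewrite /rr; case: pselect => [h|_]; rewrite ?normc0// (rP _).1.
have brr : bddf rr by exists 1.
have br n : bddf (r n) by exists 1 => x; rewrite (rP _).1.
have rxi n : Phi (dg rr) (xi n) = Phi (dg (r n)) (xi n).
  rewrite -(Dxi n) (emb_dgM hE hPhi (xi n) brr (bf_indic R (D n))).
  rewrite (emb_dgM hE hPhi (xi n) (br n) (bf_indic R (D n))).
  congr (Phi (dg _) _); apply/funext => x.
  change (rr x * \1_(D n) x = r n x * \1_(D n) x).
  rewrite indicE; have [Dx|Dx] := boolP (x \in D n); last by rewrite !mulr0.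
  by rewrite (rrD n)//; exact: set_mem.
have Brr : B (Phi (dg rr)) by apply: (emb_fun hPhi); exact: roe_dg.
(* The column bound [n] also selects the test vector [xi n], which was prepared for exactly this
   bound. *)
have [b [n [bb rb colb]]] := roe_column_finite hF hFf Brr q4.
have /choice [T TP] y : exists T : {fset Y}, (#|` T| <= n)%N /\
    forall z, z \notin T -> b (delta R y) z = 0.
  by have [T Tn T0] := colb y; exists T.
pose zeta := Phi (dg rr) (xi n).
have zeta1 : l2norm zeta = 1.
  by rewrite /zeta rxi (emb_dg_isometry hE hF hPhi hM (xi n) (rP n).1).
pose W := (\bigcup_(y <- Q n) T y)%fset.
have W_card : (#|` W| <= n * #|` Q n|)%N.
  apply: (@leq_trans (\sum_(y <- Q n) n)%N); last first.
    by rewrite big_const_seq count_predT iter_addn_0.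
  rewrite /W; elim/big_rec2: _ => [|y k V _ IH]; first by rewrite cardfs0.
  apply: leq_trans (_ : #|` T y| + #|` V| <= _)%N; first by rewrite cardfsU leq_subr.
  by rewrite leq_add// (TP y).1.
have b0 z : z \notin W -> b (fin_comb (Q n) (xi n)) z = 0.
  move=> zW; rewrite bop_sum// l2_sumE big1_seq// => y /andP[_ yQ].
  rewrite bopZ// l2ZE (TP y).2 ?mulr0//; apply: contra zW => zT.
  by apply/bigfcupP; exists y; rewrite ?yQ.
pose eta := zeta - b (fin_comb (Q n) (xi n)).
(* One quarter comes from truncating [xi n], one from approximating [Phi (dg rr)] by [b]. *)
have eta_le : l2norm eta <= 2^-1.
  have -> : eta = Phi (dg rr) (xi n - fin_comb (Q n) (xi n)) +
      (Phi (dg rr) (fin_comb (Q n) (xi n)) - b (fin_comb (Q n) (xi n))).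
    by rewrite (bopB _ _ (roe_bop Brr)) addrA subrK.
  apply: le_trans (l2normD _ _) _; rewrite (_ : 2^-1 = 4^-1 + 4^-1 :> R); last by field.
  apply: lerD.
    apply: le_trans (emb_dg_le hE hF hPhi hM _ ler01 rr1) _.
    by rewrite mul1r; apply/ltW/QP.
  apply: le_trans (rb _) _; rewrite ler_piMr ?(ltW q4)//.
  by rewrite -(xi1 n) l2norm_trunc_le.
(* Off [W] the approximant vanishes, so [zeta] and [eta] agree there. The unit mass of [zeta] is
   then at most 1/4 off [W] and 1/2 on [W], which is absurd. *)
have tail : l2norm (zeta - fin_comb W zeta) <= 2^-1.
  have -> : zeta - fin_comb W zeta = eta - fin_comb W eta.
    apply: l2P => z; rewrite !l2DE !l2NE !fin_combE.
    by case: ifPn => [_|/b0 ->]; rewrite ?subrr// !subr0.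
  apply: le_trans eta_le; rewrite -ler_sqr ?nnegrE ?l2norm_ge0//.
  by rewrite [leRHS](l2norm_trunc _ W) lerDl sumr_ge0// => z _; exact: sqr_ge0.
have head : \sum_(z <- W) normc (zeta z) ^+ 2 <= 2^-1.
  apply: (@le_trans _ _ (\sum_(z <- W) tau n)).
    by apply: ler_sum => z _; rewrite /zeta rxi; exact: (rP n).2.
  rewrite big_const_seq count_predT iter_addr_0 -[leLHS]mulr_natr /tau mulrAC.
  rewrite ler_pdivrMr// ler_pM2l ?invr_gt0// ler_nat.
  exact: leq_trans W_card (leqnSn _).
have := l2norm_trunc zeta W; rewrite zeta1 expr1n => e.
have : l2norm (zeta - fin_comb W zeta) ^+ 2 <= 2^-1 ^+ 2.
  by rewrite ler_sqr ?nnegrE ?l2norm_ge0 ?invr_ge0.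
move: e head; move: (\sum_(z <- W) _) (l2norm _ ^+ 2) => s t.
lra.
Qed.

End Total.

Theorem proposition5p1 (R : realType) (X Y : choiceType)
    (E : set (set (X * X))) (F : set (set (Y * Y)))
    (hE : coarse_space E) (hEf : uniformly_locally_finite E)
    (hF : coarse_space F) (hFf : uniformly_locally_finite F)
    (Phi : (l2 R X -> l2 R X) -> l2 R Y -> l2 R Y)
    (hPhi : embedding (uniform_roe R E) (uniform_roe R F) Phi) :
  [<-> [/\ Phi id = id,
           rank_preserving (uniform_roe R E) Phi &
           strongly_continuous (uniform_roe R E) Phi];
       exists2 u : l2 R X -> l2 R Y,
         unitary u & implemented_by (uniform_roe R E) Phi u;
       masa (bounded_op R Y Y) (Phi @` linfty R X);
       masa (uniform_roe R F) (Phi @` linfty R X)].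
Proof.
tfae.
- move=> [Phi1 rPhi cPhi]; apply: (implemented_by_unitary hE hPhi) => [x|].
    apply: rPhi; first exact: roe_indic.
    rewrite dg_set1; apply: has_rank1_rank1; apply/eqP => d0.
    by have := oner_neq0 R; rewrite -(l2norm_delta R x) d0 l2norm0 eqxx.
  exact: (strongly_continuous_total hE hPhi Phi1 cPhi).
- by move=> [u uu iu]; exact: (unitary_masa hE hPhi uu iu).
- exact: (masa_roe hE hPhi).
- move=> hM.
  have [u uu iu] := implemented_by_unitary hE hPhi
    (rank1_eproj hE hF hPhi hM) (masa_total hE hF hFf hPhi hM).
  split; first exact: (emb_id hE hF hPhi hM).
    exact: unitary_rank_preserving uu iu.
  exact: unitary_strongly_continuous uu iu.
Qed.
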